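(* Let $\mathcal{H}=\mathcal{H}(\Omega)$ be a reproducing kernel Hilbert space, let $\sigma$ be a symmetric mean with interpolation path $\sigma_t$, $t\in[0,1]$. Let $A_i,B_i\in B(\mathcal{H})$, $i=1,2,\dots,n$, where $A_i$ has polar decomposition $A_i=\mathcal{U}_i|A_i|$, and let $f,g:[0,\infty)\to[0,\infty)$ be nonnegative continuous functions. If $\sigma_t\le\nabla_t$, then for $p\ge1$ $$\left\|\sum_{i=1}^n g(|B_i|)f(|A_i^*|)\mathcal{U}_i\right\|^p_{ber_{\sigma_t}}\le\frac{n^{p-1}}{2}\sum_{i=1}^n\Big(\mathrm{ber}\left(tf^{2p}(|A_i|)+(1-t)g^{2p}(|B_i|)\right)+\mathrm{ber}\left(tg^{2p}(|B_i|)+(1-t)f^{2p}(|A_i|)\right)\Big).$$ In particular, if $f$ and $g$ are nonnegative continuous functions on $[0,\infty)$ such that $f(s)g(s)=s$ for all $s\ge 0$, then $$\left\|\sum_{i=1}^n A_i\right\|^p_{ber_{\sigma_t}}\le\frac{n^{p-1}}{2}\sum_{i=1}^n\Big(\mathrm{ber}\left(tf^{2p}(|A_i|)+(1-t)g^{2p}(|A_i^*|)\right)+\mathrm{ber}\left(tg^{2p}(|A_i^*|)+(1-t)f^{2p}(|A_i|)\right)\Big).$$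
   Context: A reproducing kernel Hilbert space $\mathcal{H}=\mathcal{H}(\Omega)$ on a nonempty set $\Omega$ is a Hilbert space of complex-valued functions on $\Omega$ whose point evaluations are bounded; $k_\lambda\in\mathcal H$ is the reproducing kernel at $\lambda\in\Omega$ (so $f(\lambda)=\langle f,k_\lambda\rangle$ for all $f\in\mathcal H$), and $\hat k_\lambda=k_\lambda/\|k_\lambda\|$ is the normalized reproducing kernel (implicitly $k_\lambda\ne 0$ for all $\lambda$). $B(\mathcal H)$ is the algebra of bounded linear operators on $\mathcal H$; $|A|=(A^*A)^{1/2}$; the polar decomposition $A=\mathcal U|A|$ has $\mathcal U$ a partial isometry; $f(|A|)$ is defined by the continuous functional calculus and $f^q(|A|)=(f(|A|))^q$. A mean is a function $\sigma:[0,\infty)\times[0,\infty)\to[0,\infty)$, written $a\,\sigma\, b=\sigma(a,b)$, such that: $\sigma(a,b)\ge 0$; $a\le b$ implies $a\le a\,\sigma\, b\le b$; $\sigma$ is increasing in both variables; $\sigma(\alpha a,\alpha b)=\alpha\,\sigma(a,b)$ for $\alpha>0$; $\sigma$ is continuous. It is symmetric if $a\,\sigma\, b=b\,\sigma\, a$ for all $a,b$. An interpolation path for a symmetric mean $\sigma$ is a family of means $\sigma_t$, $t\in[0,1]$, such that: (i) $a\,\sigma_0\, b=b$, $a\,\sigma_1\, b=a$, $a\,\sigma_{1/2}\, b=a\,\sigma\, b$ for all $a,b\ge0$; (ii) $(a\,\sigma_t\, b)\,\sigma\,(a\,\sigma_s\, b)=a\,\sigma_{(t+s)/2}\, b$ for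 all $s,t\in[0,1]$; (iii) each $\sigma_t$ is increasing in each component. The arithmetic mean $a\nabla b=(a+b)/2$ has interpolation path $a\nabla_t b=ta+(1-t)b$; $\sigma_t\le\nabla_t$ means $a\,\sigma_t\,b\le ta+(1-t)b$ for all $a,b\ge0$. For $A\in B(\mathcal H)$, $t\in[0,1]$ and $p\ge1$, the $\sigma_t$-Berezin norm is $\|A\|_{ber_{\sigma_t}}=\sup_{\lambda,\mu\in\Omega}\left(|\langle A\hat k_\lambda,\hat k_\mu\rangle|^p\,\sigma_t\,|\langle A^*\hat k_\lambda,\hat k_\mu\rangle|^p\right)^{1/p}$ (the $p$ here is the $p$ of the claim). The Berezin radius is $\mathrm{ber}(A)=\sup_{\lambda\in\Omega}|\langle A\hat k_\lambda,\hat k_\lambda\rangle|$. *)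

(* Defs.v *)
From HB Require Import structures.
From mathcomp Require Import all_boot all_order all_algebra sesquilinear.
From mathcomp Require Import complex.
From mathcomp Require Import all_classical all_reals all_analysis.

Set Implicit Arguments.
Unset Strict Implicit.
Unset Printing Implicit Defensive.

Import Order.TTheory GRing.Theory Num.Theory.
Import numFieldNormedType.Exports.

Local Open Scope classical_set_scope.
Local Open Scope complex_scope.
Local Open Scope ring_scope.

(* The elements of the space are kept abstract; [rkhs_eval] identifies each of
   them with a complex-valued function on [Omega], linearly and injectively.
   The norm of a complex normed module takes its values in [R[i]]. *)
Record rkhs (R : realType) (Omega : Type) := Rkhs {
  rkhs_space :> completeNormedModType R[i] ;
  rkhs_dot : {dot rkhs_space for (@Num.conj R[i])} ;
  rkhs_normE : forall x : rkhs_space, `|x| ^+ 2 = rkhs_dot x x ;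
  rkhs_eval : rkhs_space -> Omega -> R[i] ;
  rkhs_eval_linear : forall (a : R[i]) (x y : rkhs_space) (l : Omega),
    rkhs_eval (a *: x + y) l = a * rkhs_eval x l + rkhs_eval y l ;
  rkhs_eval_inj : forall x y : rkhs_space,
    (forall l, rkhs_eval x l = rkhs_eval y l) -> x = y ;
  rkhs_eval_bounded : forall l : Omega, exists M : R,
    forall x : rkhs_space, `|rkhs_eval x l| <= M%:C * `|x|
}.

Section Operators.
Context {R : realType} {Omega : Type} {H : rkhs R Omega}.
Local Notation C := R[i].
Local Notation dot := (rkhs_dot H).
Implicit Types (A B T U : H -> H) (l m : Omega) (f : R -> R) (p q s : R).

(* [get] returns a junk value when no object has the given property; for bounded
   operators the objects below exist and are unique (Riesz representation for
   the kernel and the adjoint, spectral theory for [cfc]). *)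
Definition rkernel l : H := get [set k : H | forall x : H, rkhs_eval x l = dot x k].

Definition nkernel l : H := `|rkernel l|^-1 *: rkernel l.

Definition bounded_op A := exists M : R, forall x, `|A x| <= M%:C * `|x|.

Definition adjoint A : H -> H :=
  get [set B : H -> H | forall x y, dot (A x) y = dot x (B y)].

Definition spectrum A : set C :=
  [set z | ~ exists B : H -> H, [/\ linear B, bounded_op B,
      forall x, B (A x - z *: x) = x & forall x, A (B x) - z *: B x = x]].

Definition poly_op (P : {poly R}) A : H -> H :=
  fun x => \sum_(i < size P) (P`_i)%:C *: iter i A x.

(* Continuous functional calculus of a self-adjoint [A], whose spectrum is real:
   [T] is the operator-norm limit of [P(A)] for real polynomials [P] converging
   to [f] uniformly on the spectrum. *)
Definition is_cfc f A T := forall e : R, 0 < e -> exists P : {poly R},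
  (forall s, spectrum A s%:C -> `|P.[s] - f s| <= e) /\
  (forall x, `|poly_op P A x - T x| <= e%:C * `|x|).

Definition cfc f A : H -> H := get [set T : H -> H | is_cfc f A T].

Definition op_abs A : H -> H := cfc Num.sqrt (adjoint A \o A).

Definition op_pow A q : H -> H := cfc (fun s => s `^ q) A.

Definition partial_isometry U :=
  forall x, (forall y, U y = 0 -> dot x y = 0) -> `|U x| = `|x|.

(* The normalisation [ker U = ker A], which makes [U] unique, is not imposed. *)
Definition polar_decomposition A U :=
  partial_isometry U /\ A = U \o op_abs A.

Definition ber A : R :=
  sup [set r | exists l, r = Normc.normc (dot (A (nkernel l)) (nkernel l))].

Definition ber_norm (sigma : R -> R -> R) p A : R :=
  sup [set r | exists l m,
    r = (sigma (Normc.normc (dot (A (nkernel l)) (nkernel m)) `^ p)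
               (Normc.normc (dot (adjoint A (nkernel l)) (nkernel m)) `^ p))
        `^ p^-1].

End Operators.

Section Means.
Context {R : realType}.
Implicit Types (sigma : R -> R -> R) (t : R).

(* A function on [0,oo) x [0,oo) is represented by a total one, of which only
   the values at nonnegative arguments matter. *)
Record is_mean sigma : Prop := IsMean {
  mean_ge0 : forall a b, 0 <= a -> 0 <= b -> 0 <= sigma a b ;
  mean_between : forall a b, 0 <= a -> a <= b -> a <= sigma a b <= b ;
  mean_increasing : forall a a' b b', 0 <= a -> a <= a' -> 0 <= b -> b <= b' ->
    sigma a b <= sigma a' b' ;
  mean_homogeneous : forall c a b, 0 < c -> 0 <= a -> 0 <= b ->
    sigma (c * a) (c * b) = c * sigma a b ;
  mean_continuous :
    {within [set z : R * R | 0 <= z.1 /\ 0 <= z.2],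
      continuous (fun z : R * R => sigma z.1 z.2)}
}.

Definition symmetric_mean sigma :=
  is_mean sigma /\ forall a b, 0 <= a -> 0 <= b -> sigma a b = sigma b a.

(* The monotonicity of each [sigmat t] is part of [is_mean]. *)
Record interpolation_path sigma (sigmat : R -> R -> R -> R) : Prop :=
  InterpolationPath {
  path_mean : forall t, 0 <= t <= 1 -> is_mean (sigmat t) ;
  path0 : forall a b, 0 <= a -> 0 <= b -> sigmat 0 a b = b ;
  path1 : forall a b, 0 <= a -> 0 <= b -> sigmat 1 a b = a ;
  path_half : forall a b, 0 <= a -> 0 <= b -> sigmat 2^-1 a b = sigma a b ;
  path_mid : forall s t a b, 0 <= s <= 1 -> 0 <= t <= 1 -> 0 <= a -> 0 <= b ->
    sigma (sigmat t a b) (sigmat s a b) = sigmat ((t + s) / 2) a b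
}.

End Means.

(* Main.v *)
Require Import Defs.
From HB Require Import structures.
From mathcomp Require Import all_boot all_order all_algebra sesquilinear.
From mathcomp Require Import complex.
From mathcomp Require Import all_classical all_reals all_analysis.
From mathcomp Require Import ring lra.
Set Implicit Arguments.
Unset Strict Implicit.
Unset Printing Implicit Defensive.
Import Order.TTheory GRing.Theory Num.Theory.
Import numFieldNormedType.Exports.
Local Open Scope classical_set_scope.
Local Open Scope complex_scope.
Local Open Scope ring_scope.

(** Fix unit vectors x and y, in the end normalised kernels.  The polar
    decomposition A = U|A| gives A A^* U = U A^* A, and the continuous functional
    calculus carries this intertwining over to f(|A^*|) U = U f(|A|)
    ([polar_intertwine]).  Since U is a contraction,
      |<g(|B|) f(|A^*|) U x, y>| = |<U f(|A|) x, g(|B|) y>|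
                                <= |f(|A|) x| |g(|B|) y|.
    The p-th power of a sum of n such terms is at most n^(p-1) times the sum of the
    p-th powers; the arithmetic-geometric inequality splits each of these into
    (|f(|A|) x|^(2p) + |g(|B|) y|^(2p)) / 2, and Jensen's inequality for positive
    operators, |F x|^(2p) <= <F^(2p) x, x>, turns both halves into quadratic forms
    ([op_pow_jensen], [dot_sum_powR_le]).

    The second argument of the mean is the same quantity with x and y exchanged,
    because <X^* x, y> is the conjugate of <X y, x>.  Bounding the mean by
    t a + (1 - t) b therefore regroups the quadratic forms into that of
    t f^(2p)(|A|) + (1 - t) g^(2p)(|B|) at x and that of
    t g^(2p)(|B|) + (1 - t) f^(2p)(|A|) at y, and each is at most a Berezin radius
    ([ber_norm_sum_le]).  For the second claim take B = A^*: when f(s) g(s) = s,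
    g(|A^*|) f(|A^*|) U = |A^*| U = U |A| = A ([polar_factorization]).

    The rest is the operator theory behind these lines.  Minimising a quadratic
    functional ([coercive_representation]) yields at once adjoints, orthogonal
    projections onto kernels, and inverses of self-adjoint operators that are bounded
    below.  For the functional calculus of a self-adjoint A the key estimate is
    |P(A)| <= sup |P| over the real spectrum ([poly_op_norm_bound]): with N the norm
    of P(A), the operator P(A)^2 - N^2 is not bounded below, so by factoring the
    polynomial P^2 - N^2 some real root of it must lie in the spectrum.  Together
    with the density of polynomials ([weierstrass_ge0]) this produces f(A)
    ([cfcP]), and shows that any polynomial close to f on the spectrum gives an
    operator close to f(A), whence its algebraic and order properties. *)

(** * Uniform approximation by polynomials *)

Section Weierstrass.
Context {R : realType}.

(** The recursion of de Casteljau for the Bernstein polynomial, the sum over k of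
    phi k binom(n, k) X^k (1 - X)^(n - k). *)
Fixpoint bernstein (n : nat) (phi : nat -> R) : {poly R} :=
  if n is n'.+1 then
    (1 - 'X) * bernstein n' phi + 'X * bernstein n' (phi \o S)
  else (phi 0)%:P.

Lemma bernsteinS n phi x : (bernstein n.+1 phi).[x] =
  (1 - x) * (bernstein n phi).[x] + x * (bernstein n (phi \o S)).[x].
Proof. by rewrite /= !hornerE. Qed.

(** The value at a point of the unit interval is a weighted mean of phi 0, ..., phi n. *)
Lemma bernstein_le n (phi psi : nat -> R) x : 0 <= x <= 1 ->
  (forall k, (k <= n)%N -> phi k <= psi k) ->
  (bernstein n phi).[x] <= (bernstein n psi).[x].
Proof.
move=> /andP[x0 x1].
elim: n phi psi => [|n IH] phi psi le_phi.
  by rewrite /= !hornerE le_phi.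
rewrite !bernsteinS lerD ?ler_wpM2l ?subr_ge0 ?IH // => k kn.
  by rewrite le_phi // leqW.
by rewrite /= le_phi.
Qed.

(** The mean of a quadratic under a binomial law with parameters n and x.  Keeping the
    centre c free lets the induction shift it by one when phi is replaced by
    phi \o S. *)
Lemma bernstein_variance n (a b c x : R) :
  (bernstein n (fun k => a + b * (k%:R - c) ^+ 2)).[x] =
  a + b * (n%:R * x * (1 - x) + (n%:R * x - c) ^+ 2).
Proof.
elim: n c => [|n IH] c; first by rewrite /= !hornerE; ring.
rewrite bernsteinS IH.
have -> : (fun k => a + b * (k%:R - c) ^+ 2) \o S =
          (fun k => a + b * (k%:R - (c - 1)) ^+ 2).
  by apply/funext => k /=; rewrite -natr1; ring.
by rewrite IH -natr1; ring.
Qed.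

(** Uniform continuity in the form in which the Bernstein estimate consumes it: a
    quadratic majorant can be averaged exactly by [bernstein_variance].  Close to the
    diagonal the compactness of the interval bounds the difference by e; away from it
    the oscillation of g is absorbed by the quadratic term. *)
Lemma quadratic_modulus (g : R -> R) : {within `[0, 1], continuous g} ->
  forall e : R, 0 < e -> exists2 C : R, 0 <= C &
    forall x y : R, 0 <= x <= 1 -> 0 <= y <= 1 -> `|g y - g x| <= e + C * (y - x) ^+ 2.
Proof.
move=> gc e e0.
have [x1 _ gmax] := @EVT_max R g 0 1 ler01 gc.
have [x2 x201 gmin] := @EVT_min R g 0 1 ler01 gc.
pose P (d x : R) := forall y : R, 0 <= y <= 1 -> `|y - x| < d -> `|g y - g x| <= e.
have : \forall d \near 0^'+, `[0, 1]%classic `<=` P d.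
  have /compact_near_coveringP/near_covering_withinP := @segment_compact R 0 1.
  apply => x x01.
  have /subspace_continuousP/(_ x x01)/cvgrPdist_lt/(_ (e / 2)) := gc.
  rewrite divr_gt0 // => /(_ isT) /nbhs_ballP[r /= r0 Hr].
  exists (ball x (r / 2), [set d : R | d < r / 2]) => /=.
    split; first by apply: nbhsx_ballx; rewrite divr_gt0.
    by apply: nbhs_right_lt; rewrite divr_gt0.
  move=> [x' d] /= [bx' dr] x'01 y y01 yx'.
  have h z : ball x r z -> 0 <= z <= 1 -> `|g x - g z| < e / 2.
    by move=> bz z01; apply: (Hr z bz); rewrite /= in_itv.
  have h1 : `|g x - g x'| < e / 2.
    apply: h => //; apply: (@le_ball _ _ _ (r / 2)) => //.
    by rewrite ler_pdivrMr // ler_peMr ?ltW // ltr1n.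
  have h2 : `|g x - g y| < e / 2.
    apply: h => //; rewrite /ball /=.
    have -> : x - y = (x - x') - (y - x') by ring.
    apply: le_lt_trans (ler_normB _ _) _; rewrite /ball /= in bx'; lra.
  have -> : g y - g x' = (g x - g x') - (g x - g y) by ring.
  by apply: le_trans (ler_normB _ _) _; lra.
move=> Hd; have [d [d0 Pd]] := filter_ex (filterI (nbhs_right_gt (0 : R)) Hd).
set M := g x1 - g x2.
have M0 : 0 <= M by rewrite subr_ge0 gmax.
have d20 : 0 < d ^+ 2 by rewrite exprn_gt0.
exists (M / d ^+ 2); first by rewrite divr_ge0 // ltW.
move=> x y x01 y01; have [yx|yx] := ltP `|y - x| d.
  apply: le_trans (Pd _ x01 _ y01 yx) _.
  by rewrite lerDl mulr_ge0 ?sqr_ge0 // divr_ge0 // ltW.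
have le1 : M <= M / d ^+ 2 * (y - x) ^+ 2.
  rewrite -mulrA ler_peMr // mulrC ler_pdivlMr // mul1r.
  by rewrite -[leRHS]real_normK ?num_real // lerXn2r ?nnegrE // ltW.
apply: le_trans (_ : M <= _); last by apply: le_trans le1 _; rewrite lerDr ltW.
have := gmax x; have := gmin x; have := gmax y; have := gmin y.
rewrite !in_itv /= x01 y01 => /(_ isT) ? /(_ isT) ? /(_ isT) ? /(_ isT) ?.
by rewrite ler_norml /M; apply/andP; split; lra.
Qed.

(** The Bernstein polynomial of degree n averages g (k / n) over k; by
    [quadratic_modulus] it differs from g x by at most e / 2 plus C times the variance
    x (1 - x) / n. *)
Lemma weierstrass01 (g : R -> R) : {within `[0, 1], continuous g} ->
  forall e : R, 0 < e -> exists P : {poly R},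
    forall x : R, 0 <= x <= 1 -> `|P.[x] - g x| <= e.
Proof.
move=> gc e e0.
have e20 : 0 < e / 2 by rewrite divr_gt0.
have [C C0 HC] := quadratic_modulus gc e20.
(* This degree makes the variance term C / n at most e / 2. *)
pose n := (Num.truncn (C / e * 2)).+1.
have n0 : 0 < n%:R :> R by rewrite ltr0n.
have Cn : C / n%:R <= e / 2.
  rewrite ler_pdivrMr //.
  have : C / e * 2 < n%:R by rewrite truncnS_gt.
  rewrite -(ltr_pM2r e20) [_ * (e / 2)]mulrC [n%:R * _]mulrC => /ltW; apply: le_trans.
  by rewrite le_eqVlt; apply/orP; left; apply/eqP; field; rewrite gt_eqF.
exists (bernstein n (fun k => g (k%:R / n%:R))) => x x01.
have kn01 k : (k <= n)%N -> 0 <= (k%:R / n%:R : R) <= 1.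
  by move=> kn; rewrite divr_ge0 // ler_pdivrMr // mul1r ler_nat.
have var a s : (bernstein n
    (fun k => a + s * C / n%:R ^+ 2 * (k%:R - n%:R * x) ^+ 2)).[x] =
    a + s * C / n%:R * (x * (1 - x)).
  by rewrite bernstein_variance; field; rewrite gt_eqF.
have sq k : C * (k%:R / n%:R - x) ^+ 2 =
    C / n%:R ^+ 2 * (k%:R - n%:R * x) ^+ 2 by field; rewrite gt_eqF.
have x1x : C / n%:R * (x * (1 - x)) <= e / 2.
  apply: le_trans Cn; rewrite ler_piMr ?divr_ge0 //; nra.
rewrite ler_norml; apply/andP; split.
  rewrite lerBrDr; apply: le_trans (bernstein_le x01 _); last first.
    move=> k kn; have := HC x _ x01 (kn01 k kn); rewrite sq ler_norml => /andP[h _].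
    instantiate (1 := fun k => (g x - e / 2) + - 1 * C / n%:R ^+ 2 *
      (k%:R - n%:R * x) ^+ 2); rewrite /=; lra.
  by rewrite var; lra.
rewrite lerBlDr; apply: le_trans (bernstein_le x01 _) _.
  move=> k kn; have := HC x _ x01 (kn01 k kn); rewrite sq ler_norml => /andP[_ h].
  instantiate (1 := fun k => (g x + e / 2) + 1 * C / n%:R ^+ 2 *
    (k%:R - n%:R * x) ^+ 2); rewrite /=; lra.
by rewrite var; lra.
Qed.

Lemma weierstrass_ge0 (f : R -> R) (N : R) : {within `[0, +oo[, continuous f} ->
  0 < N -> forall e : R, 0 < e -> exists P : {poly R},
    forall s : R, 0 <= s <= N -> `|P.[s] - f s| <= e.
Proof.
move=> fc N0 e e0.
have gc : {within `[0, 1], continuous (fun x => f (N * x))}.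
  apply/subspace_continuousP => x /=; rewrite in_itv /= => /andP[x0 _].
  apply/cvgrPdist_lt => d d0.
  have Nx0 : 0 <= N * x by rewrite mulr_ge0 // ltW.
  have /subspace_continuousP/(_ (N * x)) := fc.
  rewrite /= in_itv /= Nx0 => /(_ isT)/cvgrPdist_lt/(_ d d0) /nbhs_ballP[r /= r0 Hr].
  apply/nbhs_ballP; exists (r / N) => /=; first by rewrite divr_gt0.
  move=> z; rewrite /ball /= ltr_pdivlMr // => xz; rewrite in_itv /= => /andP[z0 _].
  apply: Hr; last by rewrite /= in_itv /= mulr_ge0 // ltW.
  by rewrite /ball /= -mulrBr normrM mulrC (gtr0_norm N0).
have [P HP] := weierstrass01 gc e0.
exists (P \Po (N^-1 *: 'X)) => s /andP[s0 sN].
rewrite horner_comp !hornerE mulrC.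
have := HP (s / N); rewrite divr_ge0 ?(ltW N0) //= ler_pdivrMr // mul1r sN.
by move=> /(_ isT); rewrite [N * _]mulrC divfK ?gt_eqF.
Qed.

End Weierstrass.

(** * Inequalities for real powers *)

Section PowerInequalities.
Context {R : realType}.
Implicit Types (a b c s p q : R).

(** The graph of a convex power lies above its tangent at c: after multiplication by p
    this is the Young inequality for s and c^(p-1). *)
Lemma powR_tangent p c s : 1 <= p -> 0 <= c -> 0 <= s ->
  c `^ p + p * c `^ (p - 1) * (s - c) <= s `^ p.
Proof.
move=> p1 c0 s0; have p0 : 0 < p by apply: lt_le_trans p1.
have cp := mulr_powRB1 c0 p0.
have [->|pn1] := eqVneq p 1.
  by rewrite subrr powRr0 !powRr1 // !mul1r; lra.
have p1' : 0 < p - 1 by rewrite subr_gt0 lt_neqAle eq_sym pn1.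
pose q := p / (p - 1); have q0 : 0 < q by rewrite divr_gt0.
have := @conjugate_powR _ s (c `^ (p - 1)) p q s0 (powR_ge0 _ _) p0 q0.
have -> : p^-1 + q^-1 = 1 by rewrite /q; field; rewrite !gt_eqF.
move=> /(_ erefl); rewrite -powRrM.
have -> : (p - 1) * q = p by rewrite /q mulrC divfK // gt_eqF.
rewrite -(ler_pM2l p0).
have -> : p * (s `^ p / p + c `^ p / q) = s `^ p + (p - 1) * c `^ p.
  by rewrite /q; field; rewrite !gt_eqF.
rewrite -cp; lra.
Qed.

(** Sum the tangent inequality at the mean m of the a i: the linear terms cancel. *)
Lemma powR_sum_le p n (a : 'I_n -> R) : 1 <= p -> (forall i, 0 <= a i) ->
  (\sum_i a i) `^ p <= n%:R `^ (p - 1) * \sum_i (a i) `^ p.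
Proof.
move=> p1 a0; have p0 : 0 < p by apply: lt_le_trans p1.
case: n a a0 => [|n] a a0.
  by rewrite !big_ord0 powR0 ?gt_eqF // mulr0.
pose N : R := n.+1%:R; have N0 : 0 < N by rewrite ltr0n.
pose m := (\sum_i a i) / N.
have s0 : 0 <= \sum_i a i by apply: sumr_ge0.
have m0 : 0 <= m by rewrite divr_ge0 // ltW.
have : \sum_(i < n.+1) (m `^ p + p * m `^ (p - 1) * (a i - m)) <=
       \sum_(i < n.+1) (a i) `^ p.
  by apply: ler_sum => i _; apply: powR_tangent.
rewrite big_split /= -mulr_sumr sumrB !sumr_const !card_ord.
rewrite -[m `^ p *+ _]mulr_natl -[m *+ _]mulr_natl -/N.
rewrite {3}/m [N * (_ / N)]mulrC divfK ?gt_eqF // subrr mulr0 addr0 => h.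
have -> : \sum_i a i = N * m by rewrite /m mulrC divfK ?gt_eqF.
rewrite powRM ?(ltW N0) // -(mulr_powRB1 (ltW N0) p0) mulrAC mulrC.
by rewrite ler_wpM2l ?powR_ge0 // mulrC.
Qed.

Lemma powR_mul_le p a b : 0 <= a -> 0 <= b ->
  (a * b) `^ p <= (a `^ (2 * p) + b `^ (2 * p)) / 2.
Proof.
move=> a0 b0; rewrite powRM //.
have sq x : x `^ (2 * p) = (x `^ p) ^+ 2.
  by rewrite mulrC powRrM powR_mulrn ?powR_ge0.
rewrite !sq; have := sqr_ge0 (a `^ p - b `^ p); rewrite sqrrB mulr2n; lra.
Qed.

Lemma powR_continuous_ge0 q : 0 < q -> {within `[0, +oo[, continuous (@powR R ^~ q)}.
Proof.
move=> q0; apply/subspace_continuousP => x /=; rewrite in_itv /= andbT => x0.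
have [->|xn] := eqVneq x 0; last first.
  have xp : 0 < x by rewrite lt_neqAle eq_sym xn.
  apply: cvg_within_filter; apply: differentiable_continuous.
  by apply/derivable1_diffP/derivable_powR; rewrite in_itv /= xp.
apply/cvgrPdist_lt => e e0; apply/nbhs_ballP; exists (e `^ q^-1) => /=.
  exact: powR_gt0.
move=> z; rewrite /ball /= sub0r normrN => ze; rewrite in_itv /= andbT => z0.
rewrite /from_subspace powR0 ?gt_eqF // sub0r normrN ger0_norm ?powR_ge0 //.
have -> : e = (e `^ q^-1) `^ q by rewrite -powRrM mulVf ?gt_eqF // powRr1 ?ltW.
by rewrite gt0_ltr_powR ?nnegrE ?powR_ge0 //; rewrite ger0_norm in ze.
Qed.

End PowerInequalities.

(** * Limiting arguments on real numbers *)

Section Scalars.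
Context {R : realType}.
Implicit Types a b K r : R.

Lemma harmonic_eventually_le (K e : R) : 0 < e ->
  exists N, forall n, (N <= n)%N -> K * harmonic n <= e.
Proof.
move=> e0; exists (Num.truncn (K / e)) => n Nn.
rewrite ler_pdivrMr // -ler_pdivrMl // mulrC ltW //.
by apply: lt_le_trans (truncnS_gt _) _; rewrite ler_nat.
Qed.

Lemma le_of_harmonic (a b K : R) : (forall n, a <= b + K * harmonic n) -> a <= b.
Proof.
move=> h; apply/ler_addgt0Pr => e e0.
have [N /(_ N (leqnn _)) HN] := harmonic_eventually_le K e0.
by apply: le_trans (h N) _; rewrite lerD2l.
Qed.

Lemma le_of_eps (a b K : R) : 0 <= K ->
  (forall e, 0 < e -> a <= b + K * e) -> a <= b.
Proof.
move=> K0 h; apply/ler_addgt0Pr => e e0.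
have K1 : 0 < K + 1 by rewrite ltr_wpDl.
apply: le_trans (h (e / (K + 1)) (divr_gt0 e0 K1)) _.
by rewrite lerD2l mulrCA ler_piMr ?(ltW e0) // ler_pdivrMr // mul1r lerDl.
Qed.

(** A quadratic with a root at 0 changes sign there unless its linear term vanishes.
    The hypothesis is used at the point - b / (a + 1), which also covers a = 0. *)
Lemma linear_le_quadratic (a b : R) : 0 <= a ->
  (forall r, 0 <= r ^+ 2 * a + 2 * r * b) -> b = 0.
Proof.
move=> a0 /(_ (- b / (a + 1))).
have -> : (- b / (a + 1)) ^+ 2 * a + 2 * (- b / (a + 1)) * b =
          - (b ^+ 2 * ((a + 2) / (a + 1) ^+ 2)).
  by field; rewrite gt_eqF // ltr_wpDl.
rewrite oppr_ge0 => h; apply/eqP; rewrite -sqrf_eq0 eq_le sqr_ge0 andbT.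
rewrite -(pmulr_lle0 _ (x := (a + 2) / (a + 1) ^+ 2)) // divr_gt0 ?exprn_gt0; lra.
Qed.

End Scalars.

(** * The real inner product underlying a complex Hilbert space *)

Section RealInnerProduct.
Context {R : realType} {Omega : Type} {H : rkhs R Omega}.
Local Notation C := R[i].
Local Notation dot := (rkhs_dot H).
Implicit Types (x y z : H) (r : R).

(** Order and minimisation arguments take place in the underlying real Hilbert space;
    [dot_ipP] leads back to the complex inner product. *)
Definition ip x y : R := complex.Re (dot x y).
Definition nm x : R := complex.Re `|x|.

Lemma ReM_real r (z : C) : complex.Re (r%:C * z) = r * complex.Re z.
Proof. by case: z => a b /=; rewrite mul0r subr0. Qed.

Lemma dotC x y : dot x y = Num.conj (dot y x).
Proof. by have := hermC dot x y; rewrite expr0 mul1r. Qed.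

Lemma ipC x y : ip x y = ip y x.
Proof. by rewrite /ip dotC; case: (dot y x) => a b. Qed.

Lemma ipDl x y z : ip (x + y) z = ip x z + ip y z.
Proof. by rewrite /ip linearDl raddfD. Qed.

Lemma ipZl r x z : ip (r%:C *: x) z = r * ip x z.
Proof. by rewrite /ip linearZl_LR ReM_real. Qed.

Lemma ipNl x z : ip (- x) z = - ip x z.
Proof. by rewrite /ip linearNl raddfN. Qed.

Lemma ipBl x y z : ip (x - y) z = ip x z - ip y z.
Proof. by rewrite ipDl ipNl. Qed.

Lemma ip0l z : ip 0 z = 0.
Proof. by rewrite /ip linear0l. Qed.

Lemma ipDr x y z : ip x (y + z) = ip x y + ip x z.
Proof. by rewrite ipC ipDl !(ipC _ x). Qed.

Lemma ipZr r x z : ip x (r%:C *: z) = r * ip x z.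
Proof. by rewrite ipC ipZl ipC. Qed.

Lemma ipNr x z : ip x (- z) = - ip x z.
Proof. by rewrite ipC ipNl ipC. Qed.

Lemma ipBr x y z : ip x (y - z) = ip x y - ip x z.
Proof. by rewrite ipDr ipNr. Qed.

Lemma ip0r x : ip x 0 = 0.
Proof. by rewrite ipC ip0l. Qed.

Definition ipE := (ipDl, ipDr, ipNl, ipNr, ipZl, ipZr, ip0l, ip0r).

Lemma normE_nm x : `|x| = (nm x)%:C.
Proof.
have := normr_ge0 x; rewrite /nm; case: `|x| => a b.
by rewrite lecE /= => /andP[/eqP -> _].
Qed.

Lemma nm_ge0 x : 0 <= nm x.
Proof. by rewrite -ler0c -normE_nm. Qed.

Lemma nm_sqr x : nm x ^+ 2 = ip x x.
Proof. by rewrite /ip -rkhs_normE normE_nm -rmorphXn. Qed.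

Lemma nm_eq0 x : nm x = 0 -> x = 0.
Proof. by move=> h; apply/normr0_eq0; rewrite normE_nm h. Qed.

Lemma nm0 : nm (0 : H) = 0.
Proof. by rewrite /nm normr0. Qed.

Lemma nmN x : nm (- x) = nm x.
Proof. by rewrite /nm normrN. Qed.

Lemma nmB x y : nm (x - y) = nm (y - x).
Proof. by rewrite /nm distrC. Qed.

Lemma nmD x y : nm (x + y) <= nm x + nm y.
Proof. by have := ler_normD x y; rewrite !normE_nm -rmorphD lecR. Qed.

Lemma nmZ r x : nm (r%:C *: x) = `|r| * nm x.
Proof. by rewrite /nm normrZ normc_def /= expr0n addr0 sqrtr_sqr ReM_real. Qed.

Lemma nm_dist x y z : nm (x - z) <= nm (x - y) + nm (y - z).
Proof. by rewrite -[x - z](subrKA y) nmD. Qed.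

Lemma le_normC x y r : (`|x| <= r%:C * `|y|) = (nm x <= r * nm y).
Proof. by rewrite !normE_nm -rmorphM lecR. Qed.

Lemma ip_le x y : ip x y <= nm x * nm y.
Proof.
have [->|y0] := eqVneq y 0; first by rewrite ip0r nm0 mulr0.
have ny : 0 < nm y.
  rewrite lt_def nm_ge0 andbT; apply: contra_neq y0; exact: nm_eq0.
have := sqr_ge0 (nm (x - (ip x y / nm y ^+ 2)%:C *: y)).
rewrite [leRHS]nm_sqr !ipE (ipC y x) -!nm_sqr.
set a := ip x y; set b := nm y => h.
have {}h : a ^+ 2 <= (nm x * b) ^+ 2.
  rewrite -subr_ge0; have b2 : 0 < b ^+ 2 by rewrite exprn_gt0.
  rewrite -(pmulr_rge0 _ (x := b^-1 ^+ 2)) ?exprn_gt0 ?invr_gt0 //.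
  apply: le_trans h _; rewrite le_eqVlt; apply/orP; left; apply/eqP.
  by field; rewrite gt_eqF.
have [a0|a0] := leP a 0; first by rewrite (le_trans a0) // mulr_ge0 ?nm_ge0.
by rewrite -(@ler_pXn2r _ 2) // nnegrE ?(ltW a0) // mulr_ge0 ?nm_ge0.
Qed.

Lemma ip_ge x y : - (nm x * nm y) <= ip x y.
Proof. by rewrite lerNl -ipNl -(nmN x) ip_le. Qed.

(** Rotate x by the phase that makes the inner product real and nonnegative. *)
Lemma normc_dot_le x y : Normc.normc (dot x y) <= nm x * nm y.
Proof.
set d := dot x y; have [->|d0] := eqVneq d 0.
  by rewrite Normc.normc0 mulr_ge0 ?nm_ge0.
pose u := Num.conj d / `|d|.
have nd : `|d| != 0 by rewrite normr_eq0.
have nu : `|u| = 1 by rewrite normf_div norm_conjC normr_id divff.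
have -> : nm x = nm (u *: x) by rewrite /nm normrZ nu mul1r.
apply: le_trans (ip_le _ _).
rewrite /ip linearZl_LR -/d /= /u. 
have -> : (d^* / `|d|)%R * d = `|d|.
  rewrite mulrAC -normCKC expr2 mulfK //.
by case: d {d0 nd nu u} => a b.
Qed.

Lemma Re_normc (z : C) : complex.Re z <= Normc.normc z.
Proof.
case: z => a b /=; apply: le_trans (ler_norm a) _.
by rewrite -sqrtr_sqr ler_wsqrtr // lerDl sqr_ge0.
Qed.

Lemma dot_ext y z : (forall x, ip x y = ip x z) -> y = z.
Proof.
move=> h; apply/eqP; rewrite -subr_eq0; apply/eqP/nm_eq0/eqP.
by rewrite -sqrf_eq0 nm_sqr ipBr h subrr.
Qed.

(** The imaginary part of the inner product is its real part after x is multiplied by - i. *)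
Lemma dot_ipP x y x' y' :
  (forall a : C, ip (a *: x) y = ip (a *: x') y') -> dot x y = dot x' y'.
Proof.
move=> h; apply/eqP; rewrite eq_complex.
have := h 1; rewrite !scale1r /ip => ->; rewrite eqxx /=.
have ReNi (z : C) : complex.Re (- 'i%C * z) = complex.Im z.
  by case: z => a b /=; ring.
by have := h (- 'i%C); rewrite /ip !linearZl_LR /= !ReNi => /eqP.
Qed.

Lemma nmZc (a : C) x : nm (a *: x) = Normc.normc a * nm x.
Proof. by rewrite /nm normrZ normE_nm -[`|a|]/((Normc.normc a)%:C) ReM_real. Qed.

Lemma norm_ip_le x y : `|ip x y| <= nm x * nm y.
Proof. by rewrite ler_norml ip_ge ip_le. Qed.

Lemma dotZr_real r x y : dot x (r%:C *: y) = r%:C * dot x y.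
Proof. by rewrite linearZr_LR; congr (_ * _); exact: conjc_real. Qed.

Lemma dot_suml n (u : 'I_n -> H) y : dot (\sum_i u i) y = \sum_i dot (u i) y.
Proof. by rewrite dotC !raddf_sum; apply: eq_bigr => i _; rewrite /= -dotC. Qed.

Lemma normc_sum_le n (z : 'I_n -> C) :
  Normc.normc (\sum_i z i) <= \sum_i Normc.normc (z i).
Proof.
elim/big_ind2: _ => // [|x1 x2 y1 y2 h1 h2]; first by rewrite Normc.normc0.
by apply: le_trans (le_normcD _ _) (lerD h1 h2).
Qed.

Lemma normc_ge0 (z : C) : 0 <= Normc.normc z.
Proof. by case: z => a b; exact: sqrtr_ge0. Qed.

End RealInnerProduct.

(** * Minimising a quadratic functional on a closed subspace *)

Section Minimisation.
Context {R : realType} {Omega : Type} {H : rkhs R Omega}.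
Local Notation C := R[i].
Local Notation dot := (rkhs_dot H).
Implicit Types (x y z : H) (r : R) (V : H -> H).

Lemma gt0_Re (e : C) : 0 < e -> exists2 r : R, 0 < r & e = r%:C.
Proof.
by case: e => a b; rewrite ltcE /= => /andP[/eqP -> a0]; exists a.
Qed.

Lemma lt_normC x r : (`|x| < r%:C) = (nm x < r).
Proof. by rewrite normE_nm ltcR. Qed.

(** A quantitative form of completeness: the explicit rate survives in the limit, so
    that later limits need no further topology. *)
Lemma harmonic_cauchy_converges (u : nat -> H) (K : R) : 0 <= K ->
  (forall n m, nm (u n - u m) <= K * (harmonic n + harmonic m)) ->
  exists l, forall n, nm (u n - l) <= K * harmonic n.
Proof.
Proof.
move=> K0 hu.
have /cvg_ex[l ul] : cvg (u @ \oo).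
  apply/cauchy_cvgP/cauchy_exP => e /gt0_Re[r r0 ->].
  have e20 : 0 < r / 2 / 2 by rewrite !divr_gt0.
  have [N HN] := harmonic_eventually_le K e20.
  exists (u N), N => //= n /= Nn; rewrite -ball_normE /= lt_normC.
  have h1 := HN _ (leqnn N); have h2 := HN _ Nn.
  by apply: le_lt_trans (hu N n) _; rewrite mulrDr; lra.
exists l => n; apply/ler_addgt0Pr => e e0.
have e20 : 0 < e / 2 by rewrite divr_gt0.
have [N HN] := harmonic_eventually_le K e20.
have eC : 0 < (e / 2)%:C :> C by rewrite (@ltcR R 0).
have /cvgrPdist_lt /(_ _ eC) [N' _ HN'] := ul.
have := HN' (maxn N N') (leq_maxr _ _); rewrite lt_normC => h1.
have h2 := HN _ (leq_maxl N N').
rewrite nmB; apply: le_trans (nm_dist _ (u (maxn N N')) _) _.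
apply: le_trans (lerD (ltW h1) (hu _ _)) _; rewrite mulrDr; lra.
Qed.

Definition rsubspace (M : H -> Prop) :=
  M 0 /\ forall r x y, M x -> M y -> M (r%:C *: x + y).

(** Closedness stated by approximation in norm, which is how it is proved and used. *)
Definition seq_closed (M : H -> Prop) :=
  forall l, (forall e, 0 < e -> exists2 y, M y & nm (y - l) <= e) -> M l.

Lemma lin0 V : linear V -> V 0 = 0.
Proof.
move=> h; have := h 1 0 0; rewrite !scale1r addr0 => /eqP.
by rewrite -subr_eq0 opprD addrA subrr sub0r oppr_eq0 => /eqP.
Qed.

Lemma linD V x y : linear V -> V (x + y) = V x + V y.
Proof. by move=> h; have := h 1 x y; rewrite !scale1r. Qed.

Lemma linZ V (a : C) x : linear V -> V (a *: x) = a *: V x.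
Proof. by move=> h; have := h a x 0; rewrite (lin0 h) !addr0. Qed.

Lemma linB V x y : linear V -> V (x - y) = V x - V y.
Proof. by move=> h; rewrite -scaleN1r (linD _ _ h) (linZ _ _ h) scaleN1r. Qed.

(** The minimiser y of J x = |V x|^2 - 2 phi x over M exists because the parallelogram
    identity makes minimising sequences Cauchy for |V .|, hence for the norm; the
    vanishing of the first variation of J at y is the asserted identity.  With V the
    identity this is the Riesz representation theorem on M, with phi an inner product
    it gives orthogonal projections, and with V self-adjoint it solves V (V y) = z. *)
Lemma coercive_representation (M : H -> Prop) V (phi : H -> R) (c K N : R) :
  rsubspace M -> seq_closed M -> linear V -> 0 < c -> 0 <= K -> 0 <= N ->
  (forall x, nm (V x) <= N * nm x) ->
  (forall x, M x -> c * nm x <= nm (V x)) ->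
  (forall r x y, phi (r%:C *: x + y) = r * phi x + phi y) ->
  (forall x, phi x <= K * nm x) ->
  exists2 y, M y & forall x, M x -> ip (V x) (V y) = phi x.
Proof.
move=> [M0 Mlin] Mcl Vlin c0 K0 N0 VN Vc philin phiK.
pose J x := nm (V x) ^+ 2 - 2 * phi x.
have phi0 : phi 0 = 0.
  by have := philin 1 0 0; rewrite scaler0 addr0 mul1r; lra.
have J_lb x : M x -> - (K ^+ 2 / c ^+ 2) <= J x.
  move=> Mx; rewrite /J; have := phiK x; have := Vc _ Mx; have := nm_ge0 x.
  set a := nm x; set b := nm (V x) => a0 ab ph.
  have b0 : 0 <= b by apply: nm_ge0.
  have sqe : (b - K / c) ^+ 2 = b ^+ 2 - 2 * (K * (b / c)) + K ^+ 2 / c ^+ 2.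
    by field; rewrite gt_eqF.
  have Kab : K * a <= K * (b / c) by rewrite ler_wpM2l // ler_pdivlMr // mulrC.
  have := sqr_ge0 (b - K / c); rewrite sqe; lra.
pose E := [set J x | x in [set x | M x]].
have Einf : has_inf E.
  split; first by exists (J 0), 0.
  by exists (- (K ^+ 2 / c ^+ 2)) => _ [x Mx <-]; apply: J_lb.
pose d := inf E.
have d_le x : M x -> d <= J x.
  by move=> Mx; apply: ge_inf; [case: Einf | exists x].
have /choice[u Hu] n : exists x, M x /\ J x < d + harmonic n ^+ 2.
  have e0 : 0 < (harmonic n : R) ^+ 2 by rewrite exprn_gt0 // harmonic_gt0.
  by have [_ [x Mx <-] hx] := inf_adherent e0 Einf; exists x.
have JD r x y : J (r%:C *: x + y) =
    J y + r ^+ 2 * nm (V x) ^+ 2 + 2 * r * (ip (V x) (V y) - phi x).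
  by rewrite /J Vlin philin !nm_sqr !ipE (ipC (V y)); ring.
have uC n m : nm (u n - u m) <= 2 / c * (harmonic n + harmonic m).
  have [Mn Jn] := Hu n; have [Mm Jm] := Hu m.
  set a := harmonic n in Jn *; set b := harmonic m in Jm *.
  have a0 : 0 <= a by rewrite harmonic_ge0.
  have b0 : 0 <= b by rewrite harmonic_ge0.
  have Mw : M (u n - u m).
    by have := Mlin (-1) _ _ Mm Mn; rewrite rmorphN1 scaleN1r addrC.
  have Mh : M (2^-1%:C *: (u n - u m) + u m) by apply: Mlin.
  have := d_le _ Mh; rewrite JD.
  have : J (u n) = J (1%:C *: (u n - u m) + u m).
    by rewrite scale1r subrK.
  rewrite JD => Je Jh.
  have := Vc _ Mw; set w := nm (V (u n - u m)) in Je Jh * => hw.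
  (* The values of J at u n, at u m and at their midpoint bound |V (u n - u m)|. *)
  have w2 : w ^+ 2 <= (2 * (a + b)) ^+ 2 by nra.
  have w0 : 0 <= w by apply: nm_ge0.
  have ww : w <= 2 * (a + b).
    by rewrite -(@ler_pXn2r _ 2) // nnegrE // mulr_ge0 // addr_ge0.
  by rewrite mulrAC ler_pdivlMr // mulrC; apply: le_trans hw ww.
have [l Hl] := harmonic_cauchy_converges (divr_ge0 (ler0n _ 2) (ltW c0)) uC.
have Ml : M l.
  apply: Mcl => e e0; have [n /(_ n (leqnn _)) Hn] := harmonic_eventually_le (2 / c) e0.
  by exists (u n); [case: (Hu n) | apply: le_trans (Hl n) Hn].
exists l => // x Mx; set a := nm (V x) ^+ 2; set b := ip (V x) (V l) - phi x.
suff key r : 0 <= r ^+ 2 * a + 2 * r * b.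
  have a0 : 0 <= a by rewrite exprn_ge0 // nm_ge0.
  by move/eqP: (linear_le_quadratic a0 key); rewrite subr_eq0 => /eqP.
(* The first variation is tested along u n, whose distance to l costs D / (n + 1). *)
pose D := nm (V x) * N * (2 / c).
apply: (@le_of_harmonic _ _ _ (1 + 2 * `|r| * D)) => n.
have [Mn Jn] := Hu n.
have := d_le _ (Mlin r _ _ Mx Mn); rewrite JD -/a.
have inv1 : harmonic n ^+ 2 <= harmonic n :> R.
  by rewrite expr2 ler_piMr ?harmonic_ge0 // invf_le1 // ler1n.
have dif : `|ip (V x) (V (u n)) - ip (V x) (V l)| <= D * harmonic n.
  rewrite -ipBr -linB //; have hV : nm (V (u n - l)) <= N * (2 / c * harmonic n).
    by apply: le_trans (VN _) _; rewrite ler_wpM2l.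
  have hV' : nm (V x) * nm (V (u n - l)) <= D * harmonic n.
    have -> : D * harmonic n = nm (V x) * (N * (2 / c * harmonic n)).
      by rewrite /D; ring.
    by rewrite ler_wpM2l ?nm_ge0.
  rewrite ler_norml lerNl; apply/andP; split; last exact: le_trans (ip_le _ _) hV'.
  by rewrite -ipNl; apply: le_trans (ip_le _ _) _; rewrite nmN.
set p := ip (V x) (V (u n)) in dif *.
have rdif : 2 * r * (p - phi x) <= 2 * r * b + 2 * `|r| * (D * harmonic n).
  have -> : 2 * r * (p - phi x) = 2 * r * b + 2 * (r * (p - ip (V x) (V l))).
    by rewrite /b; ring.
  rewrite lerD2l -mulrA ler_pM2l //; apply: le_trans (ler_norm _) _.
  by rewrite normrM ler_wpM2l.
have -> : (1 + 2 * `|r| * D) * harmonic n = harmonic n + 2 * `|r| * (D * harmonic n).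
  by ring.
lra.
Qed.

End Minimisation.

(** * Bounded operators and their adjoints *)

Section Operators.
Context {R : realType} {Omega : Type} {H : rkhs R Omega}.
Local Notation C := R[i].
Local Notation dot := (rkhs_dot H).
Implicit Types (x y z : H) (r : R) (A B T U V : H -> H).

Lemma bounded_opP A :
  bounded_op A <-> exists2 N, 0 <= N & forall x, nm (A x) <= N * nm x.
Proof.
split=> [[M hM]|[N _ hN]]; last by exists N => x; rewrite le_normC.
exists `|M| => // x; have := hM x; rewrite le_normC => /le_trans -> //.
by rewrite ler_wpM2r ?nm_ge0 // ler_norm.
Qed.

Lemma bounded_id : bounded_op (fun x : H => x).
Proof. by apply/bounded_opP; exists 1 => // x; rewrite mul1r. Qed.

Lemma bounded_comp A B : bounded_op A -> bounded_op B -> bounded_op (A \o B).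
Proof.
move=> /bounded_opP[N N0 hN] /bounded_opP[M M0 hM]; apply/bounded_opP.
exists (N * M); first exact: mulr_ge0.
by move=> x /=; apply: le_trans (hN _) _; rewrite -mulrA ler_wpM2l.
Qed.

Lemma bounded_add A B : bounded_op A -> bounded_op B -> bounded_op (A + B).
Proof.
move=> /bounded_opP[N N0 hN] /bounded_opP[M M0 hM]; apply/bounded_opP.
exists (N + M); first exact: addr_ge0.
by move=> x; rewrite mulrDl; apply: le_trans (nmD _ _) (lerD _ _).
Qed.

Lemma bounded_scale r A : bounded_op A -> bounded_op (r%:C *: A).
Proof.
move=> /bounded_opP[N N0 hN]; apply/bounded_opP.
exists (`|r| * N); first exact: mulr_ge0.
by move=> x; rewrite nmZ -mulrA ler_wpM2l.
Qed.

(** The adjoint as a relation: it can be established for explicit operators without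
    knowing that [adjoint] is well defined, and it implies linearity of both sides. *)
Definition adjoint_pair A B := forall x y, dot (A x) y = dot x (B y).

Lemma adjoint_pairC A B : adjoint_pair A B -> adjoint_pair B A.
Proof. by move=> h x y; rewrite dotC -h -dotC. Qed.

Lemma adjoint_pair_ip A B x y : adjoint_pair A B -> ip (A x) y = ip x (B y).
Proof. by rewrite /ip => ->. Qed.

Lemma adjoint_pair_linear A B : adjoint_pair A B -> linear A.
Proof.
move=> h a x y; apply: dot_ext => z; rewrite /ip dotC [in RHS]dotC.
by rewrite h !linearDl !linearZl_LR /= !h.
Qed.

(** Test the relation against B x itself. *)
Lemma adjoint_pair_bounded A B : adjoint_pair A B -> bounded_op A -> bounded_op B.
Proof.
move=> h /bounded_opP[N N0 hN]; apply/bounded_opP; exists N => // x.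
have [B0|B0] := eqVneq (nm (B x)) 0; first by rewrite B0 mulr_ge0 ?nm_ge0.
have Bp : 0 < nm (B x) by rewrite lt_def B0 nm_ge0.
rewrite -(ler_pM2l Bp) -expr2 nm_sqr -(adjoint_pair_ip _ _ h).
apply: le_trans (ip_le _ _) _.
by rewrite mulrCA mulrA ler_wpM2r ?nm_ge0.
Qed.

Lemma adjoint_pair_comp A A' B B' :
  adjoint_pair A A' -> adjoint_pair B B' -> adjoint_pair (A \o B) (B' \o A').
Proof. by move=> h h' x y; rewrite /= h h'. Qed.

Lemma adjoint_pair_sum n (A A' : 'I_n -> H -> H) :
  (forall i, adjoint_pair (A i) (A' i)) ->
  adjoint_pair (\sum_i A i) (\sum_i A' i).
Proof.
move=> h x y; rewrite !fct_sumE dotC !raddf_sum /=.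
by apply: eq_bigr => i _; rewrite -dotC h.
Qed.

Lemma adjoint_unique A B : adjoint_pair A B -> adjoint A = B.
Proof.
move=> h; have : adjoint_pair A (adjoint A) by exact: (getI (x := B)).
move=> h'; apply/funext => y; apply: dot_ext => x.
by rewrite -!(adjoint_pair_ip _ _ h) -!(adjoint_pair_ip _ _ h').
Qed.

(** Riesz representation of the functional x |-> <A x, y>, for each y. *)
Lemma adjointP A : linear A -> bounded_op A -> adjoint_pair A (adjoint A).
Proof.
move=> Alin /bounded_opP[N N0 hN].
suff /choice[B hB] : forall y, exists z, forall x, dot (A x) y = dot x z.
  have AB : adjoint_pair A B by move=> x y; apply: hB.
  by rewrite (adjoint_unique AB).
move=> y.
have [||||||||||z _ hz] := @coercive_representation R Omega H (fun=> True) id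
  (fun x => ip (A x) y) 1 (N * nm y) 1 => //.
- by rewrite mulr_ge0 ?nm_ge0.
- by move=> x; rewrite mul1r.
- by move=> x _; rewrite mul1r.
- by move=> r x x'; rewrite Alin !ipE.
- move=> x; apply: le_trans (ip_le _ _) _.
  by rewrite mulrAC ler_wpM2r ?nm_ge0.
exists z => x; apply: dot_ipP => a.
by rewrite -(linZ _ _ Alin) -hz.
Qed.

(** For each y the functional <., y> is represented as <V ., V z>; self-adjointness
    of V turns this into V (V z) = y. *)
Lemma coercive_bijective V c : adjoint_pair V V -> bounded_op V -> 0 < c ->
  (forall x, c * nm x <= nm (V x)) ->
  exists B, [/\ linear B, bounded_op B, cancel V B & cancel B V].
Proof.
move=> Vsym /bounded_opP[N N0 hN] c0 Vc.
have Vlin := adjoint_pair_linear Vsym.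
have Vinj x : V x = 0 -> x = 0.
  move=> Vx; have := Vc x; rewrite Vx nm0 pmulr_rle0 // => h.
  by apply: nm_eq0; apply/eqP; rewrite eq_le h nm_ge0.
have surj y : exists x, V x = y.
  have [||||||||||z _ hz] := @coercive_representation R Omega H (fun=> True) V
    (fun x => ip x y) c (nm y) N => //.
  - exact: nm_ge0.
  - by move=> r x x'; rewrite !ipE.
  - by move=> x; rewrite mulrC ip_le.
  exists (V z); apply: dot_ext => x; by rewrite -(adjoint_pair_ip _ _ Vsym) hz.
have [B BK] := choice surj.
have VK : cancel V B.
  move=> x; apply/eqP; rewrite -subr_eq0; apply/eqP; apply: Vinj.
  by rewrite (linB _ _ Vlin) BK subrr.
exists B; split=> //.
  by move=> a x y; rewrite -[LHS]VK -[RHS]VK !BK Vlin !BK.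
apply/bounded_opP; exists c^-1; first by rewrite invr_ge0 ltW.
by move=> x; rewrite ler_pdivlMl // -{2}[x]BK.
Qed.

(** x0 is the orthogonal projection of x onto the kernel of U, which is closed because
    U is bounded. *)
Lemma kernel_decomposition U x : linear U -> bounded_op U ->
  exists x0 x1, [/\ x = x0 + x1, U x0 = 0 & forall y, U y = 0 -> dot x1 y = 0].
Proof.
move=> Ulin /bounded_opP[N N0 hN].
have [||||||||||z Uz hz] := @coercive_representation R Omega H (fun y => U y = 0) id
  (fun y => ip y x) 1 (nm x) 1 => //.
- split; first exact: lin0.
  by move=> r y z Uy Uz; rewrite Ulin Uy Uz scaler0 addr0.
- move=> l hl; apply: nm_eq0; apply/eqP; rewrite eq_le nm_ge0 andbT.
  apply/ler_addgt0Pr => e e0; rewrite add0r.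
  have [y Uy hy] := hl (e / (N + 1)) (divr_gt0 e0 (ltr_wpDl N0 ltr01)).
  rewrite -nmN -[- U l]add0r -Uy -(linB _ _ Ulin).
  apply: le_trans (hN _) _; apply: le_trans (ler_wpM2l N0 hy) _.
  rewrite mulrCA ler_piMr ?(ltW e0) // ler_pdivrMr ?mul1r ?lerDl //; lra.
- exact: nm_ge0.
- by move=> y; rewrite mul1r.
- by move=> y _; rewrite mul1r.
- by move=> r y y'; rewrite !ipE.
- by move=> y; rewrite mulrC ip_le.
exists z, (x - z); split; rewrite ?subrKC // => y Uy.
rewrite dotC; apply/eqP; rewrite fmorph_eq0; apply/eqP.
rewrite -[RHS](linear0r (rkhs_dot H) y); apply: dot_ipP => a.
by rewrite ip0r ipBr hz ?subrr // (linZ _ _ Ulin) Uy scaler0.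
Qed.

End Operators.

(** * Polynomials in a self-adjoint operator and its spectrum *)

Section Spectral.
Context {R : realType} {Omega : Type} {H : rkhs R Omega}.
Local Notation C := R[i].
Local Notation dot := (rkhs_dot H).
Implicit Types (x y z : H) (r s : R) (A B T U V : H -> H) (P Q : {poly R}).

Lemma poly_op_widen n P A x : (size P <= n)%N ->
  poly_op P A x = \sum_(i < n) (P`_i)%:C *: iter i A x.
Proof.
move=> Pn; rewrite /poly_op (big_ord_widen n (fun i => (P`_i)%:C *: iter i A x)) //.
rewrite big_mkcond; apply: eq_bigr => i _; case: ltnP => // Pi.
by rewrite nth_default // scale0r.
Qed.

Lemma poly_opD P Q A x : poly_op (P + Q) A x = poly_op P A x + poly_op Q A x.
Proof.
pose n := maxn (size P) (size Q).
rewrite !(@poly_op_widen n) ?leq_maxl ?leq_maxr ?size_polyD //.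
rewrite -big_split; apply: eq_bigr => i _.
by rewrite coefD rmorphD scalerDl.
Qed.

Lemma poly_opZ r P A x : poly_op (r *: P) A x = r%:C *: poly_op P A x.
Proof.
rewrite !(@poly_op_widen (size P)) ?size_scale_leq // scaler_sumr.
by apply: eq_bigr => i _; rewrite coefZ rmorphM scalerA.
Qed.

Lemma poly_opC r A x : poly_op r%:P A x = r%:C *: x.
Proof. by rewrite (@poly_op_widen 1) ?size_polyC_leq1 // big_ord1 coefC. Qed.

Lemma poly_opB P Q A x : poly_op (P - Q) A x = poly_op P A x - poly_op Q A x.
Proof. by rewrite -scaleN1r poly_opD poly_opZ rmorphN1 scaleN1r. Qed.

Lemma poly_opMX P A x : poly_op (P * 'X) A x = poly_op P A (A x).
Proof.
rewrite (@poly_op_widen (size P).+1); last first.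
  by have [->|P0] := eqVneq P 0; rewrite ?mul0r ?size_poly0 // size_mulX.
rewrite big_ord_recl coefMX /= scale0r add0r; apply: eq_bigr => i _.
by rewrite coefMX /= -iterS iterSr.
Qed.

Lemma poly_opX A x : poly_op 'X A x = A x.
Proof. by rewrite -['X]mul1r poly_opMX poly_opC scale1r. Qed.

Lemma poly_op_intertwine A B U P x : linear U -> (forall x, A (U x) = U (B x)) ->
  poly_op P A (U x) = U (poly_op P B x).
Proof.
move=> Ulin AU; elim/poly_ind: P x => [|P c IH] x.
  by rewrite -[0]/0%:P !poly_opC !scale0r (lin0 Ulin).
by rewrite !poly_opD !poly_opMX !poly_opC AU IH (linD _ _ Ulin) (linZ _ _ Ulin).
Qed.

Lemma poly_opM P Q A x : linear A ->
  poly_op (P * Q) A x = poly_op P A (poly_op Q A x).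
Proof.
move=> Alin; elim/poly_ind: P x => [|P c IH] x.
  by rewrite mul0r -[0]/0%:P !poly_opC !scale0r.
rewrite mulrDl mulrAC mul_polyC !poly_opD !poly_opMX poly_opZ poly_opC IH.
by rewrite (poly_op_intertwine Q x Alin (fun _ => erefl)).
Qed.

Lemma poly_op_adjoint A P : adjoint_pair A A ->
  adjoint_pair (poly_op P A) (poly_op P A).
Proof.
move=> Asym; have Alin := adjoint_pair_linear Asym.
elim/poly_ind: P => [|P c IH] x y.
  by rewrite -[0]/0%:P !poly_opC !scale0r linear0l linear0r.
rewrite !poly_opD !poly_opMX !poly_opC linearDl linearDr /= IH Asym.
rewrite (poly_op_intertwine P y Alin (fun _ => erefl)) /=; congr (_ + _).
by rewrite linearZl_LR dotZr_real.
Qed.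

Lemma poly_op_bounded A P : bounded_op A -> bounded_op (poly_op P A).
Proof.
move=> Abd; elim/poly_ind: P => [|P c IH].
  by apply/bounded_opP; exists 0 => // x; rewrite -[0]/0%:P poly_opC scale0r nm0 mul0r.
have -> : poly_op (P * 'X + c%:P) A = (poly_op P A \o A) + c%:C *: (fun x => x).
  by apply/funext => x; rewrite poly_opD poly_opMX poly_opC.
apply: bounded_add; first exact: bounded_comp.
exact/bounded_scale/bounded_id.
Qed.

Definition bounded_below V := exists2 c : R, 0 < c & forall x, c * nm x <= nm (V x).

Lemma bounded_below_comp U V :
  bounded_below U -> bounded_below V -> bounded_below (U \o V).
Proof.
move=> [c c0 hc] [d d0 hd]; exists (c * d); first exact: mulr_gt0.
by move=> x; apply: le_trans (hc _); rewrite -mulrA ler_wpM2l // ltW.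
Qed.

(** Cauchy-Schwarz: <V x, x> <= |V x| |x|. *)
Lemma bounded_belowP V c : 0 < c -> (forall x, c * nm x ^+ 2 <= ip (V x) x) ->
  bounded_below V.
Proof.
move=> c0 hc; exists c => // x; have [->|x0] := eqVneq (nm x) 0.
  by rewrite mulr0 nm_ge0.
have xp : 0 < nm x by rewrite lt_def x0 nm_ge0.
by rewrite -(ler_pM2r xp) -mulrA -expr2; apply: le_trans (hc x) (ip_le _ _).
Qed.

Lemma adjoint_pair_shift A s : adjoint_pair A A ->
  adjoint_pair (fun x => A x - s%:C *: x) (fun x => A x - s%:C *: x).
Proof.
by move=> Asym x y; rewrite linearBl linearBr linearZl_LR /= dotZr_real Asym.
Qed.

(** For a self-adjoint operator a lower bound already forces
    surjectivity, so that membership in the real spectrum is a statement about norms. *)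
Lemma spectrumP A s : adjoint_pair A A -> bounded_op A ->
  ~ spectrum A s%:C <-> bounded_below (fun x => A x - s%:C *: x).
Proof.
move=> Asym Abd; split=> [/contrapT[B [Blin /bounded_opP[N N0 hN] BK KB]]|[c c0 hc]].
  exists (N + 1)^-1 => [|x]; first by rewrite invr_gt0 ltr_wpDl.
  rewrite ler_pdivrMl ?ltr_wpDl // -{1}[x]BK; apply: le_trans (hN _) _.
  by rewrite ler_wpM2r ?nm_ge0 // lerDl.
have Vbd : bounded_op (fun x => A x - s%:C *: x).
  have -> : (fun x => A x - s%:C *: x) = A + (- s)%:C *: (fun x => x).
    by apply/funext => x; rewrite rmorphN scaleNr.
  exact/(bounded_add Abd)/bounded_scale/bounded_id.
have [B [Blin Bbd BK KB]] :=
  coercive_bijective (adjoint_pair_shift s Asym) Vbd c0 hc.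
by apply; exists B.
Qed.

(** Factor Q over the reals.  A linear factor X - a is bounded below at A because a is
    not in the spectrum; a factor (X - a)^2 + b^2 is bounded below at A whatever the
    spectrum, its quadratic form being at least b^2 |x|^2. *)
Lemma poly_op_bounded_below A Q : adjoint_pair A A -> bounded_op A ->
  Q != 0 -> (forall s, root Q s -> ~ spectrum A s%:C) ->
  bounded_below (poly_op Q A).
Proof.
move=> Asym Abd; have Alin := adjoint_pair_linear Asym.
have [n] := ubnP (size Q); elim: n Q => // n IH Q; rewrite ltnS => Qn Q0 Qs.
(* Induction on the degree: constants, then one real factor at a time. *)
have [Q1|Q1] := eqVneq (size Q) 1%N.
  have /size_poly1P[c c0 ->] : size Q == 1%N by apply/eqP.
  exists `|c|; first by rewrite normr_gt0.
  by move=> x; rewrite poly_opC nmZ.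
pose toC := real_complex R.
have [z] : exists z : C, root (map_poly toC Q) z.
  by apply/closed_rootP; rewrite size_map_poly.
have factor (D : {poly R}) : (1 < size D)%N -> D %| Q -> bounded_below (poly_op D A) ->
    bounded_below (poly_op Q A).
  move=> D1 /dvdpP[Q' QE] Dbb.
  have [Q'0 D0] : Q' != 0 /\ D != 0.
    by apply/andP; rewrite -negb_or -mulf_eq0 -QE.
  have -> : poly_op Q A = poly_op Q' A \o poly_op D A.
    by apply/funext => x; rewrite QE poly_opM.
  apply: bounded_below_comp => //; apply: IH => //.
    apply: leq_trans Qn; rewrite QE size_mul //.
    have : (0 < size Q')%N by rewrite lt0n size_poly_eq0.
    by case: (size D) D1 => [|[|k]] // _ Q'1; rewrite !addnS /= leq_addr.
  by move=> s rs; apply: Qs; rewrite QE rootM rs.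
case: z => a b; have [->|b0] := eqVneq b 0.
  rewrite complexr0 fmorph_root => ra.
  apply: (factor ('X - a%:P)); rewrite ?size_XsubC // ?dvdp_XsubCl //.
  have -> : poly_op ('X - a%:P) A = fun x => A x - a%:C *: x.
    by apply/funext => x; rewrite poly_opB poly_opX poly_opC.
  exact/(spectrumP a Asym Abd)/Qs.
move=> rz; pose D : {poly R} := ('X - a%:P) ^+ 2 + (b ^+ 2)%:P.
have szD : size D = 3%N.
  by rewrite size_polyDl size_exp_XsubC // size_polyC; case: (b ^+ 2 != 0).
have D0 : D != 0 by rewrite -size_poly_eq0 szD.
apply: (factor D); first by rewrite szD.
  rewrite /dvdp; have szr := ltn_modp Q D; rewrite D0 szD in szr.
  have QE := divp_eq Q D; set r := Q %% D in szr QE *.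
  (* The remainder is affine and vanishes at a + ib with b != 0, hence is zero. *)
  have rE : r = r`_1 *: 'X + (r`_0)%:P.
    apply/polyP => i; rewrite coefD coefZ coefX coefC.
    case: i => [|[|i]] /=; rewrite ?mulr0 ?mulr1 ?add0r ?addr0 //.
    by rewrite nth_default // -ltnS (leq_trans szr).
  have Dz : (map_poly toC D).[a +i* b] = 0.
    rewrite rmorphD rmorphXn rmorphB /= map_polyX !map_polyC /= !hornerE /=.
    by apply/eqP; rewrite eq_complex /=; apply/andP; split; apply/eqP; ring.
  move: rz; rewrite /root QE rmorphD rmorphM /= hornerD hornerM Dz mulr0 add0r.
  rewrite rE rmorphD /= map_polyZ map_polyX map_polyC /= !hornerE /=.
  rewrite eq_complex /= => /andP[/eqP re /eqP im].
  have r1 : r`_1 = 0 by apply: (mulIf b0); lra.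
  have r0 : r`_0 = 0 by move: re; rewrite r1; lra.
  by rewrite r1 r0 scale0r add0r.
apply: (@bounded_belowP _ (b ^+ 2)); first by rewrite exprn_even_gt0.
move=> x; rewrite poly_opD poly_opC ipDl ipZl -nm_sqr lerDr expr2 poly_opM //.
by rewrite (adjoint_pair_ip _ _ (poly_op_adjoint _ Asym)) -nm_sqr sqr_ge0.
Qed.
End Spectral.

(** * The continuous functional calculus *)

Section Calculus.
Context {R : realType} {Omega : Type} {H : rkhs R Omega}.
Local Notation C := R[i].
Local Notation dot := (rkhs_dot H).
Implicit Types (x y z : H) (r s : R) (A B S T U V : H -> H) (P Q : {poly R}).

(** N is the operator norm of T.  For a unit vector x self-adjointness gives
    |T^2 x - N^2 x|^2 <= N^4 - N^2 |T x|^2, which comes arbitrarily close to 0 when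
    |T x| approaches N. *)
Lemma norm_attained_approximately T : adjoint_pair T T -> bounded_op T ->
  (exists x : H, x != 0) ->
  exists N, [/\ 0 <= N, forall x, nm (T x) <= N * nm x &
    ~ bounded_below (fun x => T (T x) - (N ^+ 2)%:C *: x)].
Proof.
move=> Tsym Tbd [x0 x00]; have Tlin := adjoint_pair_linear Tsym.
have nm_gt0 x : x != 0 -> 0 < nm x.
  by move=> h; rewrite lt_def nm_ge0 andbT; apply: contra_neq h; exact: nm_eq0.
have nm_unit x : x != 0 -> nm ((nm x)^-1%:C *: x) = 1.
  move=> /nm_gt0 h; rewrite nmZ ger0_norm ?invr_ge0 ?nm_ge0 //.
  by rewrite mulVf // gt_eqF.
pose E := [set nm (T x) | x in [set x | nm x = 1]].
pose e0 := (nm x0)^-1%:C *: x0; have e01 : nm e0 = 1 by apply: nm_unit.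
have E0 : E !=set0 by exists (nm (T e0)), e0.
have [M M0 hM] := (bounded_opP T).1 Tbd.
have Eub : has_ubound E.
  by exists M => _ [x /= x1 <-]; have := hM x; rewrite x1 mulr1.
pose N := sup E.
have N1 x : nm x = 1 -> nm (T x) <= N by move=> x1; apply: ub_le_sup => //; exists x.
have N0 : 0 <= N by apply: le_trans (N1 _ (nm_unit _ x00)); apply: nm_ge0.
have NT x : nm (T x) <= N * nm x.
  have [->|h] := eqVneq x 0; first by rewrite (lin0 Tlin) nm0 mulr0.
  have := N1 _ (nm_unit _ h); rewrite (linZ _ _ Tlin) nmZ.
  rewrite ger0_norm ?invr_ge0 ?nm_ge0 // mulrC ler_pdivrMr ?nm_gt0 //.
exists N; split=> // -[c c0 hc].
have c20 : 0 < c ^+ 2 by rewrite exprn_gt0.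
have key x : nm x = 1 -> N ^+ 2 * nm (T x) ^+ 2 <= N ^+ 4 - c ^+ 2.
  move=> x1; have := hc x; rewrite x1 mulr1 => h.
  have {}h : c ^+ 2 <= nm (T (T x) - (N ^+ 2)%:C *: x) ^+ 2.
    by rewrite lerXn2r ?nnegrE ?nm_ge0 // ltW.
  have h2 : nm (T (T x)) ^+ 2 <= N ^+ 2 * nm (T x) ^+ 2.
    by rewrite -exprMn lerXn2r ?nnegrE ?mulr_ge0 ?nm_ge0.
  move: h; rewrite nm_sqr !ipE (adjoint_pair_ip (T x) x Tsym) (ipC x).
  rewrite (adjoint_pair_ip (T x) x Tsym) -!nm_sqr x1; lra.
have [x1 hx1] : exists x, nm x = 1 by exists ((nm x0)^-1%:C *: x0); exact: nm_unit.
have [Nz|Nn] := eqVneq N 0.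
  by have := key _ hx1; rewrite Nz !expr0n /= mul0r; lra.
have Np : 0 < N by rewrite lt_def Nn.
have N2 : 0 < N ^+ 2 by rewrite exprn_gt0.
(* For unit x, |T x|^2 would stay below q < N^2, against N being the supremum. *)
pose q := N ^+ 2 - c ^+ 2 / N ^+ 2.
have qb x : nm x = 1 -> nm (T x) ^+ 2 <= q.
  move=> /key h; rewrite -(ler_pM2l N2); apply: le_trans h _.
  by rewrite le_eqVlt; apply/orP; left; apply/eqP; rewrite /q; field; rewrite gt_eqF.
have q0 : 0 <= q by apply: le_trans (qb _ hx1); rewrite sqr_ge0.
have : N <= Num.sqrt q.
  apply: ge_sup => // _ [x /= /qb xq <-].
  by rewrite -(ler_pXn2r (n := 2)) ?nnegrE ?nm_ge0 ?sqrtr_ge0 // sqr_sqrtr.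
rewrite -(ler_pXn2r (n := 2)) ?nnegrE ?sqrtr_ge0 // sqr_sqrtr // /q.
have : 0 < c ^+ 2 / N ^+ 2 by rewrite divr_gt0.
lra.
Qed.

Lemma poly_bounded N P : exists M, forall s, `|s| <= N -> `|P.[s]| <= M.
Proof.
elim/poly_ind: P => [|P c [M hM]]; first by exists 0 => s _; rewrite horner0 normr0.
exists (M * N + `|c|) => s sN; rewrite !hornerE.
apply: le_trans (ler_normD _ _) _; rewrite lerD2r normrM.
by apply: ler_pM => //; apply: hM.
Qed.

Section SelfAdjoint.
Variable A : H -> H.
Hypotheses (Asym : adjoint_pair A A) (Abd : bounded_op A).

Lemma spectral_witness Q : Q != 0 -> ~ bounded_below (poly_op Q A) ->
  exists2 s, spectrum A s%:C & Q.[s] = 0.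
Proof.
move=> Q0 nbb; apply: contrapT => h; apply: nbb.
apply: poly_op_bounded_below => // s rs sp; apply: h; exists s => //.
exact/eqP.
Qed.

Lemma poly_op_sqr_sub P c : poly_op (P ^+ 2 - c%:P) A =
  fun x => poly_op P A (poly_op P A x) - c%:C *: x.
Proof.
apply/funext => x; rewrite poly_opB poly_opC expr2 poly_opM //.
exact: adjoint_pair_linear Asym.
Qed.

(** The norm of A or its opposite is in the spectrum: X^2 - N^2 has a root there. *)
Lemma spectrum_nonempty : (exists x : H, x != 0) -> exists s, spectrum A s%:C.
Proof.
move=> /(norm_attained_approximately Asym Abd)[N [N0 _ hN]].
have [] := @spectral_witness ('X ^+ 2 - (N ^+ 2)%:P).
- by rewrite -size_poly_eq0 size_XnsubC.
- rewrite poly_op_sqr_sub; move: hN.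
  by under eq_fun do rewrite -!(poly_opX A).
by move=> s sp _; exists s.
Qed.

(** With N the norm of P(A), a real root s of P^2 - N^2 lies in the spectrum, hence
    N = |P(s)| <= e.  When P^2 - N^2 vanishes identically any point of the spectrum
    serves. *)
Lemma poly_op_norm_bound P e x : (forall s, spectrum A s%:C -> `|P.[s]| <= e) ->
  nm (poly_op P A x) <= e * nm x.
Proof.
move=> hP; have Tsym := poly_op_adjoint P Asym.
have [->|x0] := eqVneq x 0.
  by rewrite (lin0 (adjoint_pair_linear Tsym)) nm0 mulr0.
have ex0 : exists x : H, x != 0 by exists x.
have [N [N0 hN nbb]] :=
  norm_attained_approximately Tsym (poly_op_bounded P Abd) ex0.
apply: le_trans (hN x) _; rewrite ler_wpM2r ?nm_ge0 //.
suff [s sp Ps] : exists2 s, spectrum A s%:C & P.[s] ^+ 2 = N ^+ 2.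
  apply: le_trans (hP s sp); rewrite -(ger0_norm N0).
  by rewrite -(ler_pXn2r (n := 2)) ?nnegrE // !real_normK ?num_real // Ps.
pose Q := P ^+ 2 - (N ^+ 2)%:P.
have QE s : Q.[s] = P.[s] ^+ 2 - N ^+ 2 by rewrite /Q !hornerE.
have [Q0|Q0] := eqVneq Q 0.
  have [s sp] := spectrum_nonempty ex0; exists s => //.
  by apply/eqP; rewrite -subr_eq0 -QE Q0 horner0.
have [|s sp Qs] := spectral_witness Q0; first by rewrite poly_op_sqr_sub.
by exists s => //; apply/eqP; rewrite -subr_eq0 -QE Qs.
Qed.

(** A - s is bounded below by |s| - N when |s| exceeds the norm bound N of A. *)
Lemma spectrum_bounded : exists2 N, 0 <= N & forall s, spectrum A s%:C -> `|s| <= N.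
Proof.
have [N N0 hN] := (bounded_opP A).1 Abd; exists N => // s.
apply: contraPT; rewrite -ltNge => Ns; apply/spectrumP => //.
exists (`|s| - N) => [|x]; first by rewrite subr_gt0.
have : nm (s%:C *: x) <= nm (A x) + nm (A x - s%:C *: x).
  by rewrite -[nm (A x - _)]nmN; apply: le_trans (nmD _ _); rewrite opprB addrC subrK.
rewrite nmZ mulrBl; have := hN x; lra.
Qed.

(** With M an upper bound for P on the spectrum, apply [poly_op_norm_bound] to the
    distance of P from the midpoint of the interval from - e to M. *)
Lemma poly_op_lower_bound P e x : (forall s, spectrum A s%:C -> - e <= P.[s]) ->
  - e * nm x ^+ 2 <= ip (poly_op P A x) x.
Proof.
move=> hP; have [N N0 hN] := spectrum_bounded.
have [M hM] := poly_bounded N P.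
pose m := (M - e) / 2.
(* m is the midpoint and M - m the half-length of the interval from - e to M. *)
have hb s : spectrum A s%:C -> `|(P - m%:P).[s]| <= M - m.
  move=> sp; rewrite !hornerE ler_norml; have := hP _ sp.
  have := hM s (hN _ sp); rewrite ler_norml /m => /andP[]; lra.
have := poly_op_norm_bound x hb; rewrite poly_opB poly_opC => h.
have := ip_ge (poly_op P A x - m%:C *: x) x; rewrite ipBl ipZl -nm_sqr => h2.
have : nm (poly_op P A x - m%:C *: x) * nm x <= (M - m) * nm x ^+ 2.
  by rewrite expr2 mulrA ler_wpM2r ?nm_ge0.
have -> : - e = m - (M - m) by rewrite /m; field.
rewrite mulrBl; lra.
Qed.

End SelfAdjoint.

Definition positive_op A :=
  [/\ adjoint_pair A A, bounded_op A & forall x, 0 <= ip (A x) x].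

(** For s < 0 the form of A - s is at least - s times the square of the norm. *)
Lemma spectrum_ge0 A s : positive_op A -> spectrum A s%:C -> 0 <= s.
Proof.
move=> [Asym Abd A0]; apply: contraPT; rewrite -ltNge => s0; apply/spectrumP => //.
apply: (@bounded_belowP _ _ _ _ (- s)); first by rewrite oppr_gt0.
by move=> x; rewrite ipBl ipZl -nm_sqr; have := A0 x; lra.
Qed.

Section CalculusProperties.
Variable A : H -> H.
Hypotheses (Asym : adjoint_pair A A) (Abd : bounded_op A).
Implicit Types (f g : R -> R).

Lemma is_cfcE f T : is_cfc f A T <-> forall e, 0 < e -> exists P,
  (forall s, spectrum A s%:C -> `|P.[s] - f s| <= e) /\
  (forall x, nm (poly_op P A x - T x) <= e * nm x).
Proof.
split=> h e /h [P [h1 h2]]; exists P; split=> // x.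
  by rewrite -le_normC.
by rewrite le_normC.
Qed.

(** Two polynomials that are close to f on the spectrum are close to each other there,
    hence give close operators: the choice of approximations is immaterial. *)
Lemma is_cfc_approx f T P e x : is_cfc f A T ->
  (forall s, spectrum A s%:C -> `|P.[s] - f s| <= e) ->
  nm (poly_op P A x - T x) <= e * nm x.
Proof.
move=> /is_cfcE fT hP.
have K0 : 0 <= 2 * nm x by rewrite mulr_ge0 ?nm_ge0.
apply: (le_of_eps K0) => d /fT[Q [hQ hQT]].
apply: le_trans (nm_dist _ (poly_op Q A x) _) _.
have := hQT x.
have : nm (poly_op P A x - poly_op Q A x) <= (e + d) * nm x.
  rewrite -poly_opB; apply: poly_op_norm_bound => // s sp; rewrite !hornerE.
  rewrite -[_ - _](subrKA (f s)); apply: le_trans (ler_normD _ _) _.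
  by rewrite lerD ?hP // distrC hQ.
rewrite mulrDl; lra.
Qed.

Lemma is_cfc_bounded f T : is_cfc f A T ->
  exists2 K, 0 <= K & forall s, spectrum A s%:C -> `|f s| <= K.
Proof.
move=> /is_cfcE /(_ 1 ltr01)[P [hP _]].
have [N N0 hN] := spectrum_bounded Asym Abd.
have [M hM] := poly_bounded N P.
exists (`|M| + 1) => [|s sp]; first by rewrite addr_ge0.
have := hP _ sp; have := hM _ (hN _ sp); have := ler_norm M.
have := ler_normB P.[s] (P.[s] - f s); rewrite subKr; lra.
Qed.

Lemma is_cfc_bounded_op f T : is_cfc f A T -> bounded_op T.
Proof.
move=> /is_cfcE /(_ 1 ltr01)[P [_ hP]].
have [N N0 hN] := (bounded_opP _).1 (poly_op_bounded P Abd).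
apply/bounded_opP; exists (N + 1) => [|x]; first by rewrite addr_ge0.
have -> : T x = poly_op P A x - (poly_op P A x - T x) by rewrite subKr.
apply: le_trans (nmD _ _) _; rewrite nmN mulrDl lerD // hP.
Qed.

(** The polynomials approximating T are self-adjoint at A, and the relation is closed. *)
Lemma is_cfc_adjoint f T : is_cfc f A T -> adjoint_pair T T.
Proof.
move=> /is_cfcE fT x y; apply: dot_ipP => a.
apply/eqP; rewrite -subr_eq0 -normr_le0.
have K0 : 0 <= 2 * Normc.normc a * nm x * nm y.
  by rewrite !mulr_ge0 ?nm_ge0 //; case: a => ? ?; exact: sqrtr_ge0.
apply: (le_of_eps K0) => e /fT[P [_ hP]]; rewrite add0r.
have Psym := poly_op_adjoint P Asym; have Plin := adjoint_pair_linear Psym.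
have -> : ip (a *: T x) y - ip (a *: x) (T y) =
    ip (a *: x) (poly_op P A y - T y) - ip (a *: (poly_op P A x - T x)) y.
  rewrite scalerBr ipBl ipBr -(linZ _ _ Plin) (adjoint_pair_ip _ _ Psym); ring.
apply: le_trans (ler_normB _ _) _.
have h1 := norm_ip_le (a *: x) (poly_op P A y - T y).
have h2 := norm_ip_le (a *: (poly_op P A x - T x)) y.
have h3 := ler_wpM2l (nm_ge0 (a *: x)) (hP y).
have h4 : nm (a *: (poly_op P A x - T x)) * nm y <= Normc.normc a * (e * nm x) * nm y.
  rewrite nmZc ler_wpM2r ?nm_ge0 // ler_wpM2l //.
  by case: (a) => ? ?; exact: sqrtr_ge0.
rewrite nmZc in h1 h3; lra.
Qed.

(** Monotonicity of the calculus against a polynomial minorant, the form required both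
    for positivity and for Jensen's inequality. *)
Lemma is_cfc_ge f T L x : is_cfc f A T ->
  (forall s, spectrum A s%:C -> L.[s] <= f s) -> ip (poly_op L A x) x <= ip (T x) x.
Proof.
move=> /is_cfcE fT Lf.
have K0 : 0 <= 2 * nm x ^+ 2 by rewrite mulr_ge0 // sqr_ge0.
apply: (le_of_eps K0) => e /fT[P [hP hPT]].
have h1 : - e * nm x ^+ 2 <= ip (poly_op (P - L) A x) x.
  apply: poly_op_lower_bound => // s sp; rewrite !hornerE.
  have := hP _ sp; have := Lf _ sp.
  rewrite ler_norml => ? /andP[]; lra.
have := ip_le (poly_op P A x - T x) x; rewrite ipBl.
have : nm (poly_op P A x - T x) * nm x <= e * nm x ^+ 2.
  by rewrite expr2 mulrA ler_wpM2r ?nm_ge0.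
move: h1; rewrite poly_opB ipBl; lra.
Qed.

(** Multiply approximating polynomials; f and g are bounded on the spectrum, which
    controls the cross terms. *)
Lemma is_cfc_mul f g S T : is_cfc f A S -> is_cfc g A T ->
  is_cfc (fun s => f s * g s) A (S \o T).
Proof.
move=> fS gT; have [Kf Kf0 hKf] := is_cfc_bounded fS.
have [Kg Kg0 hKg] := is_cfc_bounded gT.
apply/is_cfcE => e e0.
(* The summand e keeps d below 1; the others bound the errors of the two products. *)
pose L := Kf + Kg + 3 + e; have L0 : 0 < L by rewrite /L; lra.
pose d := e / L; have d0 : 0 < d by rewrite divr_gt0.
have d1 : d <= 1 by rewrite ler_pdivrMr // mul1r /L; lra.
have dL : d * (Kf + Kg + 3) <= e.
  have : d * L = e by rewrite /d divfK // gt_eqF.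
  rewrite /L mulrDr; have : 0 <= d * e by rewrite mulr_ge0 ?ltW.
  lra.
have [P [hP hPS]] := (is_cfcE f S).1 fS d d0.
have [Q [hQ hQT]] := (is_cfcE g T).1 gT d d0.
have PK s : spectrum A s%:C -> `|P.[s]| <= Kf + 1.
  move=> sp; have := hP _ sp; have := hKf _ sp.
  have := ler_normD (P.[s] - f s) (f s); rewrite subrK; lra.
have QK s : spectrum A s%:C -> `|Q.[s]| <= Kg + 1.
  move=> sp; have := hQ _ sp; have := hKg _ sp.
  have := ler_normD (Q.[s] - g s) (g s); rewrite subrK; lra.
exists (P * Q); split=> [s sp|x].
  have -> : (P * Q).[s] - f s * g s =
      P.[s] * (Q.[s] - g s) + (P.[s] - f s) * g s by rewrite hornerM; ring.
  apply: le_trans (ler_normD _ _) _; rewrite !normrM; apply: le_trans dL.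
  have := ler_pM (normr_ge0 _) (normr_ge0 _) (PK _ sp) (hQ _ sp).
  have := ler_pM (normr_ge0 _) (normr_ge0 _) (hP _ sp) (hKg _ sp).
  lra.
rewrite poly_opM; last exact: adjoint_pair_linear Asym.
apply: le_trans (nm_dist _ (poly_op P A (T x)) _) _.
have h1 : nm (poly_op P A (poly_op Q A x) - poly_op P A (T x)) <=
    (Kf + 1) * (d * nm x).
  have Plin := adjoint_pair_linear (poly_op_adjoint P Asym).
  rewrite -(linB _ _ Plin); apply: le_trans (poly_op_norm_bound _ _ _ PK) _ => //.
  by rewrite ler_wpM2l // addr_ge0.
have h2 : nm (T x) <= (Kg + 2) * nm x.
  have := hQT x; have := poly_op_norm_bound Asym Abd x QK.
  have := nmD (poly_op Q A x) (- (poly_op Q A x - T x)); rewrite subKr nmN.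
  have := ler_wpM2r (nm_ge0 x) d1; rewrite mulrDl; lra.
have h3 := hPS (T x); have := ler_wpM2l (ltW d0) h2.
have := ler_wpM2r (nm_ge0 x) dL; rewrite /=; lra.
Qed.

Lemma is_cfc_id f T : is_cfc f A T ->
  (forall s, spectrum A s%:C -> f s = s) -> T = A.
Proof.
move=> fT fid; apply/funext => x; apply/esym/eqP; rewrite -subr_eq0.
apply/eqP/nm_eq0/eqP.
rewrite eq_le nm_ge0 andbT -(poly_opX A) -(mul0r (nm x)).
by apply: is_cfc_approx fT _ => s sp; rewrite hornerX fid // subrr normr0.
Qed.

End CalculusProperties.

(** Choose polynomials P n within 1 / (n + 1) of f on the spectrum, which lies in a
    compact interval of the half-line.  By [poly_op_norm_bound] the vectors P n (A) x
    are Cauchy at the rate |x| / (n + 1), and their limits define f(A). *)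
Lemma cfcP (f : R -> R) A : positive_op A -> {within `[0, +oo[, continuous f} ->
  is_cfc f A (cfc f A).
Proof.
move=> Apos fc; have [Asym Abd _] := Apos.
have [N N0 hN] := spectrum_bounded Asym Abd.
have /choice[P hP] n : exists P : {poly R}, forall s, spectrum A s%:C ->
    `|P.[s] - f s| <= harmonic n.
  have [P hP] := weierstrass_ge0 fc (ltr_wpDl N0 ltr01) (harmonic_gt0 n).
  exists P => s sp; apply: hP; rewrite (spectrum_ge0 Apos sp) /=.
  by apply: le_trans (ler_norm _) _; apply: le_trans (hN _ sp) _; rewrite lerDl.
have /choice[T hT] x : exists l, forall n,
    nm (poly_op (P n) A x - l) <= nm x * harmonic n.
  apply: harmonic_cauchy_converges (nm_ge0 x) _ => n m; rewrite -poly_opB mulrC.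
  apply: poly_op_norm_bound => // s sp; rewrite !hornerE.
  rewrite -[_ - _](subrKA (f s)); apply: le_trans (ler_normD _ _) _.
  by rewrite lerD ?hP // distrC hP.
apply: (getI (x := T)); apply/is_cfcE => e e0.
have [n /(_ n (leqnn n)) hn] := harmonic_eventually_le 1 e0; rewrite mul1r in hn.
exists (P n); split=> [s sp|x]; first exact: le_trans (hP n s sp) hn.
by apply: le_trans (hT x n) _; rewrite mulrC ler_wpM2r ?nm_ge0.
Qed.

Lemma cfc_positive (f : R -> R) A : positive_op A -> {within `[0, +oo[, continuous f} ->
  (forall s, 0 <= s -> 0 <= f s) -> positive_op (cfc f A).
Proof.
move=> Apos fc f0; have [Asym Abd _] := Apos; have fT := cfcP Apos fc.
split; first exact: is_cfc_adjoint fT.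
  exact: is_cfc_bounded_op fT.
move=> x; rewrite -(ip0l x) -[0](scale0r x) -[0 *: x](poly_opC 0 A).
apply: (is_cfc_ge _ _ _ fT) => // s sp; rewrite hornerC.
exact/f0/(spectrum_ge0 Apos).
Qed.

(** Polynomials in A and B are intertwined by U; one polynomial close to f on an
    interval containing both spectra transfers this to f. *)
Lemma cfc_intertwine (f : R -> R) A B U : positive_op A -> positive_op B ->
  linear U -> bounded_op U -> {within `[0, +oo[, continuous f} ->
  (forall x, A (U x) = U (B x)) ->
  forall x, cfc f A (U x) = U (cfc f B x).
Proof.
move=> Apos Bpos Ulin /bounded_opP[M M0 hM] fc AU x.
have [[Asym Abd _] [Bsym Bbd _]] := (Apos, Bpos).
have [N N0 hN] := spectrum_bounded Asym Abd.
have [N' N'0 hN'] := spectrum_bounded Bsym Bbd.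
apply/eqP; rewrite -subr_eq0; apply/eqP/nm_eq0/eqP.
rewrite eq_le nm_ge0 andbT.
have K0 : 0 <= nm (U x) + M * nm x by rewrite addr_ge0 ?mulr_ge0 ?nm_ge0.
apply: (le_of_eps K0) => e e0; rewrite add0r.
have [P hP] := weierstrass_ge0 fc (ltr_wpDl (addr_ge0 N0 N'0) ltr01) e0.
have hPA s : spectrum A s%:C -> `|P.[s] - f s| <= e.
  move=> sp; apply: hP; rewrite (spectrum_ge0 Apos sp) /=.
  have := hN _ sp; have := ler_norm s; lra.
have hPB s : spectrum B s%:C -> `|P.[s] - f s| <= e.
  move=> sp; apply: hP; rewrite (spectrum_ge0 Bpos sp) /=.
  have := hN' _ sp; have := ler_norm s; lra.
have h1 := is_cfc_approx Asym Abd (U x) (cfcP Apos fc) hPA.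
have h2 := is_cfc_approx Bsym Bbd x (cfcP Bpos fc) hPB.
apply: le_trans (nm_dist _ (poly_op P A (U x)) _) _.
rewrite nmB {2}(poly_op_intertwine P x Ulin AU) -(linB _ _ Ulin).
have := hM (poly_op P B x - cfc f B x); have := ler_wpM2l M0 h2.
rewrite mulrDl; lra.
Qed.

End Calculus.

(** * Polar decomposition and Berezin radii *)

Section Polar.
Context {R : realType} {Omega : Type} {H : rkhs R Omega}.
Local Notation C := R[i].
Local Notation dot := (rkhs_dot H).
Implicit Types (x y z : H) (r s : R) (A B F S T U V : H -> H) (P Q : {poly R}).

Lemma sqrt_continuous_within : {within `[0, +oo[, continuous (@Num.sqrt R)}.
Proof. exact/continuous_subspaceT/sqrt_continuous. Qed.

Lemma positive_gram A : linear A -> bounded_op A -> positive_op (adjoint A \o A).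
Proof.
move=> Alin Abd; have Aadj := adjointP Alin Abd.
split.
- exact: adjoint_pair_comp (adjoint_pairC Aadj) Aadj.
- exact/(bounded_comp _ Abd)/(adjoint_pair_bounded Aadj).
- by move=> x /=; rewrite (adjoint_pair_ip _ _ (adjoint_pairC Aadj)) -nm_sqr sqr_ge0.
Qed.

Lemma op_abs_positive A : linear A -> bounded_op A -> positive_op (op_abs A).
Proof.
move=> Alin Abd; apply: cfc_positive; [exact: positive_gram | |].
  exact: sqrt_continuous_within.
by move=> s _; apply: sqrtr_ge0.
Qed.

(** Multiplicativity of the calculus applied to sqrt s * sqrt s = s. *)
Lemma op_abs_sqr A : linear A -> bounded_op A -> op_abs A \o op_abs A = adjoint A \o A.
Proof.
move=> Alin Abd; have Gpos := positive_gram Alin Abd; have [Gsym Gbd _] := Gpos.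
have sq := cfcP Gpos sqrt_continuous_within.
apply: (is_cfc_id Gsym Gbd (is_cfc_mul Gsym Gbd sq sq)) => s sp.
by rewrite -expr2 sqr_sqrtr // (spectrum_ge0 Gpos sp).
Qed.

Lemma nm_op_abs A x : linear A -> bounded_op A -> nm (op_abs A x) = nm (A x).
Proof.
move=> Alin Abd; have [Ssym _ _] := op_abs_positive Alin Abd.
have Aadj := adjoint_pairC (adjointP Alin Abd).
have := congr1 (fun T => ip (T x) x) (op_abs_sqr Alin Abd); rewrite /=.
rewrite (adjoint_pair_ip _ _ Ssym) (adjoint_pair_ip _ _ Aadj) -!nm_sqr.
by move/eqP; rewrite eqrXn2 ?nm_ge0 // => /eqP.
Qed.

Lemma adjoint_linear_bounded A : linear A -> bounded_op A ->
  linear (adjoint A) /\ bounded_op (adjoint A).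
Proof.
move=> Alin Abd; have Aadj := adjointP Alin Abd; split.
  exact: adjoint_pair_linear (adjoint_pairC Aadj).
exact: adjoint_pair_bounded Aadj Abd.
Qed.

Lemma adjointK A : linear A -> bounded_op A -> adjoint (adjoint A) = A.
Proof. by move=> Alin Abd; apply/adjoint_unique/adjoint_pairC/adjointP. Qed.

(** Only the component orthogonal to the kernel survives under U. *)
Lemma partial_isometry_contraction U x : linear U -> bounded_op U ->
  partial_isometry U -> nm (U x) <= nm x.
Proof.
move=> Ulin Ubd Uiso.
have [x0 [x1 [-> Ux0 x1orth]]] := kernel_decomposition x Ulin Ubd.
have orth : ip x1 x0 = 0 by rewrite /ip x1orth.
rewrite (linD _ _ Ulin) Ux0 add0r.
have -> : nm (U x1) = nm x1 by rewrite /nm Uiso.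
rewrite -(ler_pXn2r (n := 2)) ?nnegrE ?nm_ge0 // !nm_sqr !ipE (ipC x0 x1) orth.
by rewrite addr0 add0r lerDr -nm_sqr sqr_ge0.
Qed.

(** If U preserves the norm of w, the nonnegative quadratic r |-> |y r + w|^2 -
    |U (y r + w)|^2 vanishes at r = 0, so its linear term is zero. *)
Lemma contraction_isometric U w y : linear U -> (forall x, nm (U x) <= nm x) ->
  nm (U w) = nm w -> ip (U w) (U y) = ip w y.
Proof.
move=> Ulin Ucontr Uw.
have sqle x : nm (U x) ^+ 2 <= nm x ^+ 2 by rewrite lerXn2r ?nnegrE ?nm_ge0.
have a0 : 0 <= nm y ^+ 2 - nm (U y) ^+ 2 by rewrite subr_ge0.
suff /eqP : ip w y - ip (U w) (U y) = 0 by rewrite subr_eq0 => /eqP ->.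
apply: (linear_le_quadratic a0) => r.
have := sqle (r%:C *: y + w); rewrite Ulin !nm_sqr !ipE -!nm_sqr Uw.
rewrite (ipC (U y)) (ipC y); lra.
Qed.

Section PolarDecomposition.
Variables (A U : H -> H).
Hypotheses (Alin : linear A) (Abd : bounded_op A).
Hypotheses (Ulin : linear U) (Ubd : bounded_op U) (AU : polar_decomposition A U).

(** A^* U = |A|: the operator U is isometric on the range of |A|, where
    [contraction_isometric] lets it be cancelled. *)
Lemma polar_adjoint y : adjoint A (U y) = op_abs A y.
Proof.
have [Uiso AE] := AU; apply: dot_ext => x.
have [Ssym _ _] := op_abs_positive Alin Abd.
rewrite -(adjoint_pair_ip _ _ (adjointP Alin Abd)) -(adjoint_pair_ip _ _ Ssym).
rewrite {1}AE /=; apply: contraction_isometric => //.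
  by move=> z; apply: partial_isometry_contraction.
by rewrite nm_op_abs // {2}AE.
Qed.

(** A A^* U = A |A| = U |A|^2 = U A^* A, and the square root is a function of both. *)
Lemma polar_intertwine_abs x : op_abs (adjoint A) (U x) = U (op_abs A x).
Proof.
have [A'lin A'bd] := adjoint_linear_bounded Alin Abd.
have [_ AE] := AU.
apply: cfc_intertwine => //; [exact: positive_gram | exact: positive_gram | |].
  exact: sqrt_continuous_within.
(* Here A A^* U z = A |A| z is compared with U (A^* A) z. *)
move=> z; rewrite /= adjointK // polar_adjoint {1}AE /=.
by have /(congr1 (fun T => U (T z))) := op_abs_sqr Alin Abd.
Qed.

Lemma polar_intertwine (f : R -> R) x : {within `[0, +oo[, continuous f} ->
  cfc f (op_abs (adjoint A)) (U x) = U (cfc f (op_abs A) x).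
Proof.
move=> fc; have [A'lin A'bd] := adjoint_linear_bounded Alin Abd.
apply: cfc_intertwine => //; try exact: op_abs_positive.
exact: polar_intertwine_abs.
Qed.

(** g(|A^*|) f(|A^*|) = |A^*| by multiplicativity, and |A^*| U = U |A| = A. *)
Lemma polar_factorization (f g : R -> R) :
  {within `[0, +oo[, continuous f} -> {within `[0, +oo[, continuous g} ->
  (forall s, 0 <= s -> f s * g s = s) ->
  cfc g (op_abs (adjoint A)) \o cfc f (op_abs (adjoint A)) \o U = A.
Proof.
move=> fc gc fg; have [A'lin A'bd] := adjoint_linear_bounded Alin Abd.
have Spos := op_abs_positive A'lin A'bd; have [Ssym Sbd _] := Spos.
have -> : cfc g (op_abs (adjoint A)) \o cfc f (op_abs (adjoint A)) =
    op_abs (adjoint A).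
  apply: (is_cfc_id Ssym Sbd
    (is_cfc_mul Ssym Sbd (cfcP Spos gc) (cfcP Spos fc))) => s sp.
  by rewrite mulrC fg // (spectrum_ge0 Spos sp).
by apply/funext => x /=; rewrite polar_intertwine_abs; case: AU => _ {2}->.
Qed.

End PolarDecomposition.

(** With c = |F x|^2, the tangent of u |-> u^p at c, taken at u = s^2, is a polynomial
    minorant of s^(2p); its quadratic form at x is c^p because <F^2 x, x> = c. *)
Lemma op_pow_jensen F p x : positive_op F -> 1 <= p -> nm x = 1 ->
  nm (F x) `^ (2 * p) <= ip (op_pow F (2 * p) x) x.
Proof.
move=> Fpos p1 x1; have [Fsym Fbd _] := Fpos.
have p0 : 0 < p by apply: lt_le_trans p1.
have p20 : 0 < 2 * p by rewrite mulr_gt0.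
have Flin := adjoint_pair_linear Fsym.
have sq a : 0 <= a -> a `^ (2 * p) = (a ^+ 2) `^ p.
  by move=> a0; rewrite powRrM powR_mulrn.
pose c := nm (F x) ^+ 2; have c0 : 0 <= c by rewrite sqr_ge0.
pose b := p * c `^ (p - 1).
pose L : {poly R} := (c `^ p - b * c)%:P + b *: ('X * 'X).
have Lx : ip (poly_op L F x) x = c `^ p.
  rewrite poly_opD poly_opC poly_opZ poly_opM // !poly_opX !ipE.
  by rewrite (adjoint_pair_ip _ _ Fsym) -!nm_sqr x1 -/c; ring.
rewrite sq ?nm_ge0 // -/c -Lx; apply: (is_cfc_ge Fsym Fbd x).
  exact/cfcP/powR_continuous_ge0.
move=> s sp; have s0 := spectrum_ge0 Fpos sp.
rewrite sq //; apply: le_trans (powR_tangent p1 c0 (sqr_ge0 s)).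
rewrite /L hornerD hornerC hornerZ hornerM hornerX le_eqVlt; apply/orP; left.
by apply/eqP; rewrite /b; ring.
Qed.

Lemma op_pow_positive F q : positive_op F -> 0 < q -> positive_op (op_pow F q).
Proof.
move=> Fpos q0; apply: cfc_positive => //; first exact: powR_continuous_ge0.
by move=> s _; apply: powR_ge0.
Qed.

(** The power mean inequality for the sum, the arithmetic-geometric inequality for each
    term, and Jensen's inequality for each factor. *)
Lemma dot_sum_powR_le n (X F G : 'I_n -> H -> H) p x y :
  (forall i, positive_op (F i)) -> (forall i, positive_op (G i)) ->
  (forall i u v, Normc.normc (dot (X i u) v) <= nm (F i u) * nm (G i v)) ->
  1 <= p -> nm x = 1 -> nm y = 1 ->
  Normc.normc (dot ((\sum_i X i) x) y) `^ p <=
  n%:R `^ (p - 1) / 2 *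
  \sum_i (ip (op_pow (F i) (2 * p) x) x + ip (op_pow (G i) (2 * p) y) y).
Proof.
move=> Fpos Gpos XFG p1 x1 y1; have p0 : 0 < p by apply: lt_le_trans p1.
apply: le_trans (_ : (\sum_i nm (F i x) * nm (G i y)) `^ p <= _).
  rewrite ge0_ler_powR ?nnegrE ?normc_ge0 ?(ltW p0) //.
    by apply: sumr_ge0 => i _; rewrite mulr_ge0 ?nm_ge0.
  rewrite fct_sumE dot_suml; apply: le_trans (normc_sum_le _) _.
  by apply: ler_sum => i _; apply: XFG.
apply: le_trans (powR_sum_le p1 _) _; first by move=> i; rewrite mulr_ge0 ?nm_ge0.
rewrite -mulrA ler_wpM2l ?powR_ge0 // mulrC mulr_suml; apply: ler_sum => i _.
apply: le_trans (powR_mul_le _ (nm_ge0 _) (nm_ge0 _)) _.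
by rewrite ler_wpM2r ?invr_ge0 // lerD // op_pow_jensen.
Qed.

Hypothesis kernel_neq0 : forall l : Omega, rkernel l != 0 :> H.

Lemma nm_nkernel l : nm (nkernel l : H) = 1.
Proof.
by rewrite /nm /nkernel normrZ normfV normr_id mulVf ?normr_eq0.
Qed.

Lemma nkernel_le_ber T l : bounded_op T ->
  ip (T (nkernel l : H)) (nkernel l) <= ber T.
Proof.
move=> /bounded_opP[N N0 hN]; apply: le_trans (Re_normc _) _.
apply: ub_le_sup; last by exists l.
exists N => _ [m ->]; apply: le_trans (normc_dot_le _ _) _.
by rewrite nm_nkernel mulr1; have := hN (nkernel m); rewrite nm_nkernel mulr1.
Qed.

(** The adjoint exchanges the two kernels up to conjugation, so both arguments of the
    mean are moduli of the form of X. *)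
Lemma ber_norm_powR_le (sigma : R -> R -> R) t p X X' (M : R) :
  [set: Omega] !=set0 -> 1 <= p -> 0 <= t <= 1 -> is_mean sigma ->
  (forall a b, 0 <= a -> 0 <= b -> sigma a b <= t * a + (1 - t) * b) ->
  adjoint_pair X X' ->
  (forall l m : Omega,
     t * Normc.normc (dot (X (nkernel l)) (nkernel m)) `^ p +
     (1 - t) * Normc.normc (dot (X (nkernel m)) (nkernel l)) `^ p <= M) ->
  ber_norm sigma p X `^ p <= M.
Proof.
move=> [l0 _] p1 t01 sm sle XX' hM; have p0 : 0 < p by apply: lt_le_trans p1.
rewrite /ber_norm (adjoint_unique XX').
set E := [set r | _].
have conjE l m : Normc.normc (dot (X' (nkernel l)) (nkernel m)) =
    Normc.normc (dot (X (nkernel m)) (nkernel l)).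
  rewrite (adjoint_pairC XX') dotC.
  by case: (dot (X _) _) => a b /=; rewrite sqrrN.
have Eub : ubound E (M `^ p^-1).
  move=> _ [l [m ->]]; rewrite conjE; set a := _ `^ p; set b := _ `^ p.
  have [a0 b0] : 0 <= a /\ 0 <= b by split; apply: powR_ge0.
  have sM : sigma a b <= M by apply: le_trans (sle _ _ a0 b0) (hM l m).
  have s0 := mean_ge0 sm a0 b0.
  by rewrite ge0_ler_powR ?nnegrE ?invr_ge0 ?(ltW p0) // (le_trans s0 sM).
have E0 : E !=set0 by eexists; exists l0, l0; reflexivity.
have supE : 0 <= sup E.
  have [r Er] := E0; apply: le_trans (ub_le_sup (ex_intro _ _ Eub) Er).
  by case: Er => l [m ->]; apply: powR_ge0.
have M0 : 0 <= M.
  apply: le_trans (hM l0 l0); case/andP: t01 => ? ?.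
  by rewrite addr_ge0 // mulr_ge0 ?powR_ge0 ?subr_ge0.
have -> : M = (M `^ p^-1) `^ p by rewrite -powRrM mulVf ?gt_eqF // powRr1.
rewrite ge0_ler_powR ?nnegrE ?powR_ge0 ?(ltW p0) //; exact: ge_sup.
Qed.

(** [dot_sum_powR_le] at the kernels of l and m and with l and m exchanged; the forms
    collected at l and those collected at m are the two families on the right. *)
Lemma ber_norm_sum_le (sigma : R -> R -> R) t p n (X X' F G : 'I_n -> H -> H) :
  [set: Omega] !=set0 -> 1 <= p -> 0 <= t <= 1 -> is_mean sigma ->
  (forall a b, 0 <= a -> 0 <= b -> sigma a b <= t * a + (1 - t) * b) ->
  (forall i, adjoint_pair (X i) (X' i)) ->
  (forall i, positive_op (F i)) -> (forall i, positive_op (G i)) ->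
  (forall i u v, Normc.normc (dot (X i u) v) <= nm (F i u) * nm (G i v)) ->
  ber_norm sigma p (\sum_i X i) `^ p <= n%:R `^ (p - 1) / 2 *
   \sum_i
     (ber (t%:C *: op_pow (F i) (2 * p) + (1 - t)%:C *: op_pow (G i) (2 * p))
      + ber (t%:C *: op_pow (G i) (2 * p) + (1 - t)%:C *: op_pow (F i) (2 * p))).
Proof.
move=> Om0 p1 t01 sm sle XX' Fpos Gpos XFG.
have p20 : 0 < 2 * p by rewrite mulr_gt0 // (lt_le_trans _ p1).
apply: (ber_norm_powR_le Om0 p1 t01 sm sle (adjoint_pair_sum XX')) => l m.
case/andP: t01 => t0 t1.
set x := nkernel l; set y := nkernel m.
have x1 : nm x = 1 := nm_nkernel l; have y1 : nm y = 1 := nm_nkernel m.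
have h1 := dot_sum_powR_le Fpos Gpos XFG p1 x1 y1.
have h2 := dot_sum_powR_le Fpos Gpos XFG p1 y1 x1.
have t1' : 0 <= 1 - t by rewrite subr_ge0.
apply: le_trans (lerD (ler_wpM2l t0 h1) (ler_wpM2l t1' h2)) _.
rewrite !(mulrCA _ (n%:R `^ (p - 1) / 2)) -mulrDr ler_wpM2l ?divr_ge0 ?powR_ge0 //.
rewrite !mulr_sumr -big_split; apply: ler_sum => i _ /=.
have [_ Fbd _] := op_pow_positive (Fpos i) p20.
have [_ Gbd _] := op_pow_positive (Gpos i) p20.
have := nkernel_le_ber l
  (bounded_add (bounded_scale t Fbd) (bounded_scale (1 - t) Gbd)).
have := nkernel_le_ber m
  (bounded_add (bounded_scale t Gbd) (bounded_scale (1 - t) Fbd)).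
rewrite !ipDl !ipZl -/x -/y; lra.
Qed.

End Polar.

(** * The Berezin norm inequality *)

Theorem theorem3p8 (R : realType) (Omega : Type) (H : rkhs R Omega)
  (Omega_nonempty : [set: Omega] !=set0)
  (kernel_neq0 : forall l : Omega, rkernel l != 0 :> H)
  (sigma : R -> R -> R) (sigmat : R -> R -> R -> R)
  (sigma_sym : symmetric_mean sigma)
  (sigmat_path : interpolation_path sigma sigmat)
  (n : nat) (n_gt0 : (0 < n)%N)
  (A B U : 'I_n -> {linear H -> H})
  (A_bounded : forall i, bounded_op (A i))
  (B_bounded : forall i, bounded_op (B i))
  (U_bounded : forall i, bounded_op (U i))
  (A_polar : forall i, polar_decomposition (A i) (U i))
  (f g : R -> R)
  (f_ge0 : forall s, 0 <= s -> 0 <= f s)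
  (g_ge0 : forall s, 0 <= s -> 0 <= g s)
  (f_cont : {within `[0, +oo[, continuous f})
  (g_cont : {within `[0, +oo[, continuous g})
  (t : R) (t01 : 0 <= t <= 1)
  (sigmat_le_nabla : forall a b, 0 <= a -> 0 <= b ->
    sigmat t a b <= t * a + (1 - t) * b)
  (p : R) (p_ge1 : 1 <= p) :
  ber_norm (sigmat t) p
      (\sum_(i < n) (cfc g (op_abs (B i)) \o cfc f (op_abs (adjoint (A i))) \o U i))
    `^ p
  <= n%:R `^ (p - 1) / 2 *
     \sum_(i < n)
       (ber (t%:C *: op_pow (cfc f (op_abs (A i))) (2 * p)
             + (1 - t)%:C *: op_pow (cfc g (op_abs (B i))) (2 * p))
        + ber (t%:C *: op_pow (cfc g (op_abs (B i))) (2 * p)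
             + (1 - t)%:C *: op_pow (cfc f (op_abs (A i))) (2 * p)))
  /\
  ((forall s, 0 <= s -> f s * g s = s) ->
   ber_norm (sigmat t) p (\sum_(i < n) (A i : H -> H)) `^ p
   <= n%:R `^ (p - 1) / 2 *
      \sum_(i < n)
        (ber (t%:C *: op_pow (cfc f (op_abs (A i))) (2 * p)
              + (1 - t)%:C *: op_pow (cfc g (op_abs (adjoint (A i)))) (2 * p))
         + ber (t%:C *: op_pow (cfc g (op_abs (adjoint (A i)))) (2 * p)
              + (1 - t)%:C *: op_pow (cfc f (op_abs (A i))) (2 * p)))).
Proof.
have sm := path_mean sigmat_path t01.
have lin (V : {linear H -> H}) : linear V by move=> a x y; apply: linearP.
have part1 (B' : 'I_n -> H -> H) :
    (forall i, linear (B' i)) -> (forall i, bounded_op (B' i)) ->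
    ber_norm (sigmat t) p
      (\sum_(i < n) (cfc g (op_abs (B' i)) \o cfc f (op_abs (adjoint (A i))) \o U i))
    `^ p
    <= n%:R `^ (p - 1) / 2 *
     \sum_(i < n)
       (ber (t%:C *: op_pow (cfc f (op_abs (A i))) (2 * p)
             + (1 - t)%:C *: op_pow (cfc g (op_abs (B' i))) (2 * p))
        + ber (t%:C *: op_pow (cfc g (op_abs (B' i))) (2 * p)
             + (1 - t)%:C *: op_pow (cfc f (op_abs (A i))) (2 * p))).
  move=> B'lin B'bd.
  have Fpos i : positive_op (cfc f (op_abs (A i))).
    by apply: cfc_positive => //; apply: op_abs_positive.
  have Gpos i : positive_op (cfc g (op_abs (B' i))).
    by apply: cfc_positive => //; apply: op_abs_positive.
  have Kpos i : positive_op (cfc f (op_abs (adjoint (A i)))).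
    have [? ?] := adjoint_linear_bounded (lin (A i)) (A_bounded i).
    by apply: cfc_positive => //; apply: op_abs_positive.
  have Gsym i : adjoint_pair (cfc g (op_abs (B' i))) (cfc g (op_abs (B' i))).
    by case: (Gpos i).
  have Ksym i : adjoint_pair (cfc f (op_abs (adjoint (A i))))
      (cfc f (op_abs (adjoint (A i)))).
    by case: (Kpos i).
  apply: ber_norm_sum_le => //.
    move=> i; apply: adjoint_pair_comp; first exact: adjoint_pair_comp.
    by apply: adjointP.
  move=> i u v /=.
  rewrite (polar_intertwine (lin _) (A_bounded i) (lin _) (U_bounded i) (A_polar i)) //.
  rewrite (Gsym i); apply: le_trans (normc_dot_le _ _) _.
  rewrite ler_wpM2r ?nm_ge0 //; apply: partial_isometry_contraction => //.
  by case: (A_polar i).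
split=> [|fg]; first by apply: part1.
have := part1 (fun i => adjoint (A i)).
have -> : \sum_(i < n) (cfc g (op_abs (adjoint (A i))) \o
    cfc f (op_abs (adjoint (A i))) \o U i) = \sum_(i < n) (A i : H -> H).
  by apply: eq_bigr => i _; apply: polar_factorization.
apply=> i.
  by case: (adjoint_linear_bounded (lin (A i)) (A_bounded i)).
by case: (adjoint_linear_bounded (lin (A i)) (A_bounded i)).
Qed.
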